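(* Let $f:\mathbb{R}^d\to\mathbb{R}$ be smooth, $1\le k\le d-1$, let $x^*$ be an index-$k$ saddle point of $f$, and let $\delta>0$, $L\ge\mu>0$ be such that for every $x\in\mathbb{R}^d$ with $\|x-x^*\|_2\le\delta$ the eigenvalues $\lambda_1\le\dots\le\lambda_d$ of $\nabla^2f(x)$ satisfy $$-L\le\lambda_1\le\cdots\le\lambda_k\le-\mu<0<\mu\le\lambda_{k+1}\le\cdots\le\lambda_d\le L .$$ Let $R^*=I-2\sum_{i=1}^kv_i^*(v_i^* )^\top$, where $v_1^*,\dots,v_k^*$ are orthonormal eigenvectors of $\nabla^2f(x^* )$ for its $k$ negative eigenvalues. If $0<\Delta t<\frac1{2L}$, then the numerical scheme $$x_{n+1}=x_n-\Delta t\,R_n\nabla f(x_n),\qquad \bar R_{n+1}=R_n+\Delta t\big(\nabla^2f(x_n)-R_n\nabla^2f(x_n)R_n\big),\qquad R_{n+1}=\mathrm{Orth}(\bar R_{n+1})$$ is locally contractive (and hence asymptotically linearly stable) at $(x^*,R^* )$.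
   Context: An index-$k$ saddle point of $f$ is a point $x^*$ with $\nabla f(x^* )=0$ such that $\nabla^2f(x^* )$ has exactly $k$ negative eigenvalues. For a real symmetric $d\times d$ matrix $\bar R=V\Sigma V^\top$ (eigendecomposition with $V$ orthogonal and the eigenvalues in $\Sigma$ in increasing order, with a gap between the $k$-th and the $(k+1)$-st), put $$\mathrm{Orth}(\bar R)=V\operatorname{diag}(\underbrace{-1,\dots,-1}_{k},1,\dots,1)V^\top .$$ The scheme is regarded as the iteration of a map $(x_n,R_n)\mapsto(x_{n+1},R_{n+1})$ defined near $(x^*,R^* )$ in $\mathbb{R}^d\times\mathrm{Sym}_d$, where $\mathrm{Sym}_d$ is the space of real symmetric $d\times d$ matrices. Locally contractive at $(x^*,R^* )$ means that $(x^*,R^* )$ is a fixed point of this map and the spectral radius of the Jacobian of the map at $(x^*,R^* )$ is strictly less than $1$. *)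

(* Defs.v *)
From HB Require Import structures.
From mathcomp Require Import all_boot all_order all_algebra.
From mathcomp Require Import complex.
From mathcomp Require Import all_classical all_reals all_analysis.

Set Implicit Arguments.
Unset Strict Implicit.
Unset Printing Implicit Defensive.

Import Order.TTheory GRing.Theory Num.Theory numFieldNormedType.Exports.

Local Open Scope classical_set_scope.
Local Open Scope ring_scope.

Section Calculus.
Context {R : realType} {d : nat}.
Implicit Types (f : 'cV[R]_d -> R) (x : 'cV[R]_d) (A : 'M[R]_d).

(* The library norm on matrices is the max norm. *)
Definition norm2 x : R := Num.sqrt (\sum_i x i 0 ^+ 2).

Definition partial (i : 'I_d) f x : R := 'D_(delta_mx i 0) f x.

Fixpoint is_C (n : nat) f : Prop :=
  if n is n'.+1 then
    (forall x, differentiable f x) /\ (forall i, is_C n' (partial i f))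
  else continuous f.

Definition smooth f : Prop := forall n, is_C n f.

Definition gradient f x : 'cV[R]_d := \col_i partial i f x.

Definition hessian f x : 'M[R]_d := \matrix_(i, j) partial i (partial j f) x.

(* [l] lists the eigenvalues of [A] with multiplicity, in increasing order; in
   particular all eigenvalues of [A] are real. *)
Definition is_spectrum A (l : d.-tuple R) : Prop :=
  sorted <=%R l /\ char_poly A = \prod_(a <- l) ('X - a%:P).

Definition index_saddle (k : nat) f x : Prop :=
  gradient f x = 0 /\
  exists2 l : d.-tuple R,
    is_spectrum (hessian f x) l & count (fun a => a < 0) l = k.

End Calculus.

Section SymmetricMatrices.
Context (R : realType) (d : nat).

Definition symv : {vspace 'M[R]_d} := lker (linfun (@trmx R d d) - \1)%VF.

Lemma mem_symv (A : 'M[R]_d) : (A \in symv) = (A^T == A).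
Proof. by rewrite memv_ker add_lfunE opp_lfunE id_lfunE lfunE /= subr_eq0. Qed.

Definition Sym : predArgType := subvs_of symv.

HB.instance Definition _ := Vector.on Sym.
HB.instance Definition _ := SubType.on Sym.

Definition Sym_norm (S : Sym) : R := `|vsval S|.

Lemma Sym_normD (S T : Sym) : Sym_norm (S + T) <= Sym_norm S + Sym_norm T.
Proof. exact: ler_normD. Qed.

Lemma Sym_normZ (a : R) (S : Sym) : Sym_norm (a *: S) = `|a| * Sym_norm S.
Proof. exact: normrZ. Qed.

Lemma Sym_norm_eq0 (S : Sym) : Sym_norm S = 0 -> S = 0.
Proof. by move/normr0_eq0 => S0; apply: val_inj. Qed.

HB.instance Definition _ :=
  Lmodule_isNormed.Build R Sym Sym_normD Sym_normZ Sym_norm_eq0.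

End SymmetricMatrices.

Section Orth.
Context {R : realType} {d : nat}.
Implicit Types A B : 'M[R]_d.

(* Rows and columns are numbered from 0, so the first [k] indices are those
   with [i < k]. *)
Definition is_orth (k : nat) A B : Prop :=
  exists (V : 'M[R]_d) (s : 'rV[R]_d),
    [/\ V^T *m V = 1%:M,
        A = V *m diag_mx s *m V^T,
        (forall i j : 'I_d, (i <= j)%N -> s 0 i <= s 0 j),
        (forall i j : 'I_d, (i < k <= j)%N -> s 0 i < s 0 j)
      & B = V *m diag_mx (\row_(i < d) if (i < k)%N then -1 else 1) *m V^T].

(* [is_orth k A] determines its second argument; [Orth k A] is that matrix when
   [A] is in the domain of Orth, and the dummy value 0 otherwise. *)
Definition in_Orth_domain (k : nat) A : Prop := exists B, is_orth k A B.

Definition Orth (k : nat) A : Sym R d :=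
  xget 0 [set B : Sym R d | is_orth k A (vsval B)].

End Orth.

Section Scheme.
Context {R : realType} {d : nat}.
Variables (f : 'cV[R]_d -> R) (k : nat) (dt : R).

Definition scheme_Rbar (z : 'cV[R]_d * Sym R d) : 'M[R]_d :=
  let H := hessian f z.1 in let S := vsval z.2 in S + dt *: (H - S *m H *m S).

Definition scheme_map (z : 'cV[R]_d * Sym R d) : 'cV[R]_d * Sym R d :=
  (z.1 - dt *: (vsval z.2 *m gradient f z.1), Orth k (scheme_Rbar z)).

End Scheme.

(* The eigenvalues are those of [A] over the complex numbers. *)
Definition spectral_radius {R : realType} {n : nat} (A : 'M[R]_n) : R :=
  sup [set ComplexField.Normc.normc z | z in
        [set z : R[i] | eigenvalue (map_mx (real_complex R) A) z]].

Section Stability.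
Context {R : realType} {d : nat}.
Notation E := ('cV[R]_d * Sym R d)%type.
Implicit Types (Phi : E -> E) (z : E).

Definition jacobian_mx Phi z :=
  let b := vbasis {: E} in passmx.mxof b b (linfun ('d Phi z)).

Definition locally_contractive Phi z : Prop :=
  [/\ Phi z = z, differentiable Phi z & spectral_radius (jacobian_mx Phi z) < 1].

(* Orbits started close to [z] stay close and converge at a linear rate. *)
Definition asymptotically_linearly_stable Phi z : Prop :=
  exists C rho : R, 0 <= rho < 1 /\
    \forall w \near z, forall n : nat,
      `|iter n Phi w - z| <= C * rho ^+ n * `|w - z|.

End Stability.

(* Main.v *)
From mathcomp Require Import fingroup perm.
Require Import Defs.
From HB Require Import structures.
From mathcomp Require Import all_boot all_order all_algebra.
From mathcomp Require Import complex ring lra.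
From mathcomp Require Import all_classical all_reals all_analysis.

Set Implicit Arguments.
Unset Strict Implicit.
Unset Printing Implicit Defensive.

Import Order.TTheory GRing.Theory Num.Theory numFieldNormedType.Exports.

Local Open Scope classical_set_scope.
Local Open Scope ring_scope.

(** Write H for the Hessian of f at x*, S for R*, and A for S H.

The matrix S is the matrix sign of H: the projection onto the span of the v_i
is the spectral projection Q of H onto its negative eigenvalues, since Q fixes
every v_i and the two projections have the same rank k
([reflection_diagonalized]).  So S and H commute, A is the absolute value of
H, S H S = H, and (x*, S) is a fixed point as soon as Orth(S) = S.

The map Orth is the matrix sign near S: it replaces every eigenvalue by its
sign, and a trace count shows that exactly k eigenvalues stay negative.  It is
differentiable at S with derivative E |-> (E - S E S) / 2, the projection on
the symmetric matrices that anticommute with S.  This is read off from the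
Newton-Schulz step A |-> (3 A - A^3) / 2, which agrees with the sign up to
second order near an involution because the scalar function
sg s - (3 s - s^3) / 2 vanishes to second order at s = 1 and s = -1
([sign_near_involution], [Orth_near_involution], [is_diff_Orth]).

Differentiating the scheme at (x*, S) gives a block triangular linear map,
  (xi, sigma) |-> ((I - dt A) xi,
                   Pi (sigma - dt (A sigma + sigma A) + 2 dt H'(xi))),
where Pi is the above projection.  In an orthonormal eigenbasis of H both
diagonal blocks act entrywise: the first multiplies the coordinate i of xi by
1 - dt |l_i|, and the second multiplies the entry (i, j) of sigma by 0 when
l_i and l_j have the same sign and by 1 - dt (|l_i| + |l_j|) otherwise
([scheme_R_coordinates]).  As mu <= |l_i| <= L and 2 L dt < 1, all these
factors lie in [0, 1 - dt mu].

The max norm in the eigenbasis, with a small weight on sigma to absorb the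
off-diagonal block 2 dt Pi H', is therefore contracted by the derivative
([eigen_norm_contracts]).  A norm contracted by the derivative bounds the
spectral radius of the Jacobian ([spectral_radius_le]) and gives linear
convergence of the nonlinear iteration ([adapted_norm_linear_stability]). *)

(** * Spectral theorem for real symmetric matrices *)

Section RealSpectral.
Context {R : rcfType}.

(** Over the complex numbers a real symmetric matrix is Hermitian, hence
    unitarily diagonalizable with real diagonal; any diagonal entry is an
    eigenvalue, and being real it is already an eigenvalue over the base field. *)
Lemma symmetric_eigenvalue n (A : 'M[R]_n.+1) : A^T = A ->
  exists a : R, eigenvalue A a.
Proof.
move=> symA; pose Ac := map_mx (real_complex R) A.
have Ah : Ac \is hermsymmx.
  apply: realsym_hermsym.
    by apply/is_hermitianmxP; rewrite expr0 scale1r map_mx_id // /Ac map_trmx symA.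
  by apply/mxOverP => i j; rewrite mxE complex_real.
have /hermitian_normalmx /orthomx_spectralP eAc := Ah.
have /mxOverP/(_ 0 0) := hermitian_spectral_diag_real Ah.
move=> /RRe_real ea; exists (complex.Re (spectral_diag Ac 0 0)).
rewrite -(eigenvalue_map (real_complex R)) /= ea -/Ac.
set P := spectralmx Ac in eAc; have Pu : P \in unitmx by exact: spectral_unit.
apply/eigenvalueP; exists (row 0 P); last first.
  apply/negP => /eqP P0; move: Pu; rewrite -row_free_unit => /row_freeP [Q PQ].
  have := congr1 (row 0) PQ; rewrite row_mul P0 mul0mx => /rowP/(_ 0).
  by rewrite !mxE /= => /eqP; rewrite eq_sym oner_eq0.
rewrite -row_mul [X in P *m X]eAc !mulmxA mulmxV // mul1mx row_mul.
by rewrite row_diag_mx -scalemxAl -rowE.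
Qed.

(** The reflection that swaps the unit vector with the first basis vector
    provides an orthogonal matrix with a prescribed first column. *)
Lemma householder_reflection n (u : 'cV[R]_n.+1) : u^T *m u = 1%:M ->
  exists Q : 'M[R]_n.+1, [/\ Q^T = Q, Q *m Q = 1%:M & Q *m delta_mx 0 0 = u].
Proof.
move=> u1; pose e : 'cV[R]_n.+1 := delta_mx 0 0.
have [ue|ue] := eqVneq u e.
  by exists 1%:M; rewrite trmx1 !mul1mx ue.
pose w := u - e; pose c := (w^T *m w) 0 0.
have wwE : w^T *m w = c%:M by exact: mx11_scalar.
have cE : c = \sum_i w i 0 ^+ 2.
  by rewrite /c mxE; apply: eq_bigr => i _; rewrite mxE expr2.
have c0 : c != 0.
  apply: contra ue; rewrite cE psumr_eq0 => [/allP w0|i _]; last exact: sqr_ge0.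
  rewrite -subr_eq0; apply/eqP/matrixP => i j; rewrite ord1 [RHS]mxE.
  by have := w0 i; rewrite mem_index_enum sqrf_eq0 => /(_ isT)/eqP.
have e1 : e^T *m e = 1%:M.
  by rewrite /e trmx_delta mul_delta_mx; apply/matrixP => i j; rewrite !ord1 !mxE.
have we : w^T *m e = (- (c / 2))%:M.
  have ue_eq : e^T *m u = u^T *m e.
    rewrite [LHS]mx11_scalar [RHS]mx11_scalar; congr (_%:M).
    by rewrite !mxE; apply: eq_bigr => i _; rewrite !mxE mulrC.
  have : w^T *m w = (- 2) *: (w^T *m e).
    rewrite /w [trmx _]linearB /= mulmxBl !mulmxBr u1 ue_eq e1 mulmxBl e1.
    by rewrite -[- (_ - _)]scaleN1r scalerBr scaleNr scale1r scalerBr !scaleNr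
       !scaler_nat !mulr2n ; apply/matrixP=> i j; rewrite !mxE; ring.
  rewrite wwE => /(congr1 (fun M => (- 2^-1) *: M)).
  rewrite scalerA mulNr mulrN mulVf ?pnatr_eq0 // opprK scale1r => <-.
  by rewrite scale_scalar_mx mulNr mulrC.
exists (1%:M - (2 / c) *: (w *m w^T)); split.
- by rewrite [trmx _]linearB /= trmx1 linearZ /= trmx_mul trmxK.
- rewrite mulmxBl mul1mx mulmxBr mulmx1 -scalemxAl -scalemxAr.
  rewrite mulmxA -(mulmxA w) wwE mul_mx_scalar -scalemxAl !scalerA.
  rewrite (_ : 2 / c * (2 / c * c) = 2 / c + 2 / c); last by field.
  by rewrite scalerDl; apply/matrixP=> i j; rewrite !mxE; ring.
- rewrite mulmxBl mul1mx -scalemxAl -mulmxA we mul_mx_scalar scalerA.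
  rewrite (_ : _ * _ = -1); last by field.
  by rewrite scaleN1r opprK addrC subrK.
Qed.

(** Deflation: conjugating by the reflection that sends the first basis vector
    to a unit eigenvector makes the first column, hence by symmetry the first
    row, diagonal; induction applies to the remaining block. *)
Lemma symmetric_diagonalization n (A : 'M[R]_n) : A^T = A ->
  exists (V : 'M[R]_n) (s : 'rV[R]_n),
    V^T *m V = 1%:M /\ A = V *m diag_mx s *m V^T.
Proof.
elim: n A => [|n IH] A symA.
  by exists 1%:M, 0; split; apply/matrixP => -[].
have [a /eigenvalueP[x xA x0]] := symmetric_eigenvalue symA.
have [u u1 Au] : exists2 u : 'cV[R]_n.+1, u^T *m u = 1%:M & A *m u = a *: u.
  pose c := \sum_i x 0 i ^+ 2.
  have c0 : 0 < c.
    rewrite lt_neqAle sumr_ge0 ?andbT => [|i _]; last exact: sqr_ge0.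
    rewrite eq_sym; apply: contra x0.
    rewrite psumr_eq0 => [/allP h|i _]; last exact: sqr_ge0.
    apply/eqP/rowP => i; rewrite [RHS]mxE; have := h i.
    by rewrite mem_index_enum sqrf_eq0 => /(_ isT)/eqP.
  exists ((Num.sqrt c)^-1 *: x^T).
    rewrite [trmx _]linearZ /= trmxK -scalemxAl -scalemxAr scalerA -invfM -expr2.
    rewrite sqr_sqrtr ?ltW // [x *m _]mx11_scalar.
    have -> : (x *m x^T) 0 0 = c.
      by rewrite mxE; apply: eq_bigr => i _; rewrite mxE expr2.
    by rewrite scale_scalar_mx mulVf ?gt_eqF.
  rewrite -scalemxAr -{1}symA -trmx_mul xA [trmx _]linearZ /= !scalerA.
  by rewrite mulrC.
have [Q [Qt QQ Qe]] := householder_reflection u1.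
have [B BE] : {B : 'M[R]_(1 + n) | B = Q *m A *m Q} by exists (Q *m A *m Q).
have symB : B^T = B by rewrite BE !trmx_mul Qt symA mulmxA.
have Bcol : B *m delta_mx 0 0 = a *: (delta_mx 0 0 : 'cV[R]_n.+1).
  rewrite BE -!mulmxA Qe Au -scalemxAr -Qe mulmxA QQ mul1mx //.
have Bi i : B i 0 = a *+ (i == 0).
  have /matrixP/(_ i 0) := Bcol; rewrite -colE mxE => ->.
  by rewrite !mxE eqxx andbT mulr_natr.
have l0 : lshift n (0 : 'I_1) = (0 : 'I_n.+1) by apply/val_inj.
have B21 : dlsubmx B = 0.
  by apply/matrixP => i j; rewrite !mxE ord1 l0 Bi.
have symE i j : B i j = B j i by rewrite -{1}symB mxE.
have B12 : ursubmx B = 0.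
  by apply/matrixP => i j; rewrite !mxE ord1 symE l0 Bi.
have B11 : ulsubmx B = a%:M.
  by apply/matrixP => i j; rewrite !mxE !ord1 l0 Bi.
have [V [s [VV Bs]]] : exists (V : 'M[R]_n) (s : 'rV[R]_n),
    V^T *m V = 1%:M /\ drsubmx B = V *m diag_mx s *m V^T.
  by apply: IH; rewrite trmx_drsub symB.
pose W : 'M[R]_(1 + n) := block_mx 1%:M 0 0 V.
have WW : W^T *m W = 1%:M.
  rewrite /W tr_block_mx !trmx0 trmx1 mulmx_block !mulmx0 !mul0mx VV !mulmx1.
  by rewrite !addr0 add0r -scalar_mx_block.
have BW : B = W *m diag_mx (row_mx a%:M s) *m W^T.
  rewrite -[LHS]submxK B11 B12 B21 Bs /W tr_block_mx !trmx0 trmx1 diag_mx_row.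
  rewrite !mulmx_block !mulmx0 !mul0mx !mul1mx !mulmx1 !addr0 !add0r.
  have aM : a%:M = diag_mx (a%:M : 'rV[R]_1) by apply/matrixP=> i j; rewrite !ord1 !mxE.
  by rewrite -aM mul0mx.
exists (Q *m W), (row_mx a%:M s); split.
  by rewrite trmx_mul Qt -mulmxA (mulmxA Q) QQ mul1mx WW.
have -> : A = Q *m B *m Q by rewrite BE !mulmxA QQ mul1mx -mulmxA QQ mulmx1.
by rewrite BW trmx_mul Qt !mulmxA.
Qed.

(** Used to identify the diagonal of an eigendecomposition with a list of roots
    of the characteristic polynomial. *)
Lemma char_poly_diagonalized n (V : 'M[R]_n) (s : 'rV[R]_n) :
  V^T *m V = 1%:M ->
  char_poly (V *m diag_mx s *m V^T) = \prod_i ('X - (s 0 i)%:P).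
Proof.
move=> VV; pose P := map_mx polyC V.
have PP : P *m P^T = 1%:M.
  by rewrite /P map_trmx -map_mxM (mulmx1C VV) map_mx1.
have -> : char_poly (V *m diag_mx s *m V^T) = char_poly (diag_mx s).
  rewrite /char_poly /char_poly_mx.
  have -> : 'X%:M - map_mx polyC (V *m diag_mx s *m V^T)
      = P *m ('X%:M - map_mx polyC (diag_mx s)) *m P^T.
    rewrite mulmxBr mulmxBl !map_mxM -map_trmx -/P mul_mx_scalar -scalemxAl PP.
    by rewrite scalemx1.
  by rewrite !det_mulmx mulrAC -det_mulmx PP det1 mul1r.
rewrite char_poly_trig ?diag_mx_is_trig //.
by apply: eq_bigr => i _; rewrite mxE eqxx.
Qed.

Lemma diagonalizedE n (V : 'M[R]_n) (s : 'rV[R]_n) i j :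
  (V *m diag_mx s *m V^T) i j = \sum_m V i m * s 0 m * V j m.
Proof. by rewrite mul_mx_diag mxE; apply: eq_bigr => m _; rewrite !mxE. Qed.

(** Two factorizations of the characteristic polynomial into linear factors have
    the same multiset of roots, so permuting the columns of the eigenbasis puts
    the eigenvalues in any prescribed order. *)
Lemma diagonalization_by_roots n (A : 'M[R]_n) (l : n.-tuple R) :
  A^T = A -> char_poly A = \prod_(a <- l) ('X - a%:P) ->
  exists2 V : 'M[R]_n, V^T *m V = 1%:M &
    A = V *m diag_mx (\row_i tnth l i) *m V^T.
Proof.
move=> symA chA; have [V [s [VV As]]] := symmetric_diagonalization symA.
have /tuple_permP [p lp] : perm_eq l [tuple s 0 i | i < n].
  apply: prod_XsubC_eq; rewrite -chA As char_poly_diagonalized // big_tuple.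
  by apply: eq_bigr => i _; rewrite tnth_mktuple.
have lpE i : tnth l i = s 0 (p i).
  have -> : l = [tuple tnth [tuple s 0 i | i < n] (p i) | i < n] by exact/val_inj.
  by rewrite !tnth_mktuple.
exists (col_perm p V).
  rewrite col_permE trmx_mul -mulmxA (mulmxA V^T) VV mul1mx tr_perm_mx.
  by rewrite -perm_mxM mulVg perm_mx1.
apply/matrixP => i j; rewrite As !diagonalizedE (reindex_inj (@perm_inj _ p)).
by apply: eq_bigr => m _; rewrite !mxE lpE.
Qed.

Lemma symmetric_sorted_roots n (A : 'M[R]_n) : A^T = A ->
  exists2 l : n.-tuple R, sorted <=%R l & char_poly A = \prod_(a <- l) ('X - a%:P).
Proof.
move=> /symmetric_diagonalization [V [s [VV ->]]].
exists (sort_tuple <=%R [tuple s 0 i | i < n]).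
  exact: (sort_sorted (@le_total _ R)).
rewrite char_poly_diagonalized //.
have /(perm_big _) -> : perm_eq (sort_tuple <=%R [tuple s 0 i | i < n])
    [tuple s 0 i | i < n] by rewrite perm_sort.
by rewrite big_tuple; apply: eq_bigr => i _; rewrite tnth_mktuple.
Qed.

End RealSpectral.

(** * Max-norm estimates for matrices *)

Section MaxNorm.
Context {R : realType}.

Lemma mx_norm_le m n (A : 'M[R]_(m, n)) (c : R) : 0 <= c ->
  (forall i j, `|A i j| <= c) -> `|A| <= c.
Proof.
by move=> c0 Ac; rewrite [leLHS]/Num.Def.normr /= mx_normrE; apply: bigmax_le => // -[].
Qed.

Lemma mx_entry_le m n (A : 'M[R]_(m, n)) i j : `|A i j| <= `|A|.
Proof.
rewrite [leRHS]/Num.Def.normr /= mx_normrE.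
exact: (le_bigmax _ (fun ij => `|A ij.1 ij.2|) (i, j)).
Qed.

Lemma mulmx_norm_le m n p (A : 'M[R]_(m, n)) (B : 'M[R]_(n, p)) :
  `|A *m B| <= n%:R * `|A| * `|B|.
Proof.
apply: mx_norm_le => [|i j]; first by rewrite !mulr_ge0.
rewrite mxE (le_trans (ler_norm_sum _ _ _)) //.
apply: le_trans (_ : \sum_(l < n) `|A| * `|B| <= _); last first.
  by rewrite sumr_const card_ord -mulrA mulr_natl.
by apply: ler_sum => l _; rewrite normrM ler_pM // mx_entry_le.
Qed.

Lemma trmx_norm m n (A : 'M[R]_(m, n)) : `|A^T| = `|A|.
Proof.
apply/le_anti/andP; split; apply: mx_norm_le => // i j.
  by rewrite mxE mx_entry_le.
by have := mx_entry_le A^T j i; rewrite mxE.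
Qed.

Lemma mxtrace_norm_le n (A : 'M[R]_n) : `|\tr A| <= n%:R * `|A|.
Proof.
rewrite (le_trans (ler_norm_sum _ _ _)) //.
apply: le_trans (_ : \sum_(l < n) `|A| <= _); last first.
  by rewrite sumr_const card_ord mulr_natl.
by apply: ler_sum => l _; rewrite mx_entry_le.
Qed.

Lemma orthogonal_norm_le1 n (V : 'M[R]_n) : V^T *m V = 1%:M -> `|V| <= 1.
Proof.
move=> VV; apply: mx_norm_le => // i j.
have /matrixP/(_ j j) := VV; rewrite !mxE eqxx (bigD1 i) //= mxE => Vj.
have : V i j * V i j <= 1.
  rewrite -[leRHS]Vj lerDl sumr_ge0 // => m _.
  by rewrite mxE -expr2 sqr_ge0.
by rewrite -expr2 -real_normK ?num_real // expr_le1.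
Qed.

Lemma mul3mx_norm_le n (A B C : 'M[R]_n) (a b c : R) :
  `|A| <= a -> `|B| <= b -> `|C| <= c ->
  `|A *m B *m C| <= n%:R ^+ 2 * (a * b * c).
Proof.
move=> Aa Bb Cc; apply: le_trans (mulmx_norm_le _ _) _.
have -> : n%:R ^+ 2 * (a * b * c) = n%:R * (n%:R * (a * b)) * c by ring.
apply: ler_pM => //.
apply: ler_wpM2l => //; apply: le_trans (mulmx_norm_le _ _) _.
by rewrite -mulrA; apply: ler_wpM2l => //; apply: ler_pM.
Qed.

(** * The matrix sign near an involution *)

(** The cubic is the Newton-Schulz iteration for the sign.  For nonzero s and
    t = |s| the left side is (t - 1)^2 (t + 2) / 2 and the right side is
    (t - 1)^2 (t + 1)^2. *)
Lemma sg_cubic_bound (s : R) :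
  `|Num.sg s - 2^-1 * (3 * s - s ^+ 3)| <= (s ^+ 2 - 1) ^+ 2.
Proof.
have pos (t : R) : 0 < t -> `|1 - 2^-1 * (3 * t - t ^+ 3)| <= (t ^+ 2 - 1) ^+ 2.
  move=> t0; have -> : 1 - 2^-1 * (3 * t - t ^+ 3) = (t - 1) ^+ 2 * ((t + 2) / 2).
    by field.
  have -> : (t ^+ 2 - 1) ^+ 2 = (t - 1) ^+ 2 * (t + 1) ^+ 2 by ring.
  have t2 : 0 <= (t + 2) / 2 by lra.
  rewrite ger0_norm; last by apply: mulr_ge0 t2; exact: sqr_ge0.
  by apply: ler_wpM2l; [exact: sqr_ge0 | nra].
have [s0|s0|->] := ltgtP s 0.
- rewrite ltr0_sg // -normrN.
  have := pos (- s); rewrite oppr_gt0 => /(_ s0); rewrite sqrrN.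
  by congr (`|_| <= _); ring.
- by rewrite gtr0_sg //; exact: pos.
- by rewrite sgr0 !expr0n /= !(mulr0, subr0, normr0) sqr_ge0.
Qed.

(** The first-order part of the Newton-Schulz step at an involution S; every
    term on the right side is at least quadratic in E. *)
Lemma newton_schulz_expand n (S E : 'M[R]_n) : S *m S = 1%:M ->
  let A := S + E in
  2^-1 *: (3 *: A - A *m A *m A) - S - 2^-1 *: (E - S *m E *m S) =
  - 2^-1 *: (S *m E *m E + E *m S *m E + E *m E *m S + E *m E *m E).
Proof.
move=> SS /=.
have -> : (S + E) *m (S + E) *m (S + E) =
    S + E + E + E + S *m E *m S - E
    + (S *m E *m E + E *m S *m E + E *m E *m S + E *m E *m E).
  rewrite !mulmxDl !mulmxDr !mulmxDl SS mul1mx -(mulmxA E) SS mulmx1.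
  rewrite mul1mx.
  move: (S *m E *m S) (S *m E *m E) (E *m S *m E) (E *m E *m S) (E *m E *m E).
  by move=> ? ? ? ? ?; apply/matrixP => i j; rewrite !mxE; ring.
move: (S *m E *m S) (S *m E *m E) (E *m S *m E) (E *m E *m S) (E *m E *m E).
by move=> ? ? ? ? ?; apply/matrixP => i j; rewrite !mxE; field.
Qed.

Lemma sum_sg n (s : 'rV[R]_n) : (forall i, s 0 i != 0) ->
  \sum_i Num.sg (s 0 i) = n%:R - 2 * #|[pred i | s 0 i < 0]|%:R.
Proof.
move=> s0; rewrite (eq_bigr (fun i => 1 - 2 * (s 0 i < 0)%R%:R)); last first.
  move=> i _; have := s0 i; have [h|h|//] := ltrgtP (s 0 i) 0; move=> _.
    by rewrite ltr0_sg //=; ring.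
  by rewrite gtr0_sg //=; ring.
rewrite sumrB sumr_const card_ord -mulr_sumr -natr_sum; congr (_ - _ * _%:R).
by rewrite -sum1_card [RHS]big_mkcond; apply: eq_bigr => i _; rewrite !inE; case: ifP.
Qed.

Lemma conj_diag_diff n (V : 'M[R]_n) (s t : 'rV[R]_n) :
  V *m diag_mx s *m V^T - V *m diag_mx t *m V^T = V *m diag_mx (s - t) *m V^T.
Proof. by rewrite -mulmxBl -mulmxBr -linearB. Qed.

Lemma conj_diag_scale n (V : 'M[R]_n) (s : 'rV[R]_n) a :
  a *: (V *m diag_mx s *m V^T) = V *m diag_mx (a *: s) *m V^T.
Proof. by rewrite scalemxAl scalemxAr -linearZ. Qed.

Lemma conj_diag_mul n (V : 'M[R]_n) (s t : 'rV[R]_n) : V^T *m V = 1%:M ->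
  V *m diag_mx s *m V^T *m (V *m diag_mx t *m V^T) =
  V *m diag_mx (\row_i (s 0 i * t 0 i)) *m V^T.
Proof.
move=> VV; rewrite -!mulmxA (mulmxA V^T) VV mul1mx !mulmxA; congr (_ *m _).
by rewrite -mulmxA mulmx_diag.
Qed.

Lemma diag_mx_norm_le n (s : 'rV[R]_n) c : 0 <= c ->
  (forall i, `|s 0 i| <= c) -> `|diag_mx s| <= c.
Proof.
move=> c0 sc; apply: mx_norm_le => // i j; rewrite mxE.
by case: eqP => _; rewrite ?mulr1n ?mulr0n ?normr0.
Qed.

(** The matrix with the signs of the eigenvalues of S + E differs from the
    Newton-Schulz step of S + E by a conjugated diagonal matrix whose entries are
    at most (s_i^2 - 1)^2; the s_i^2 - 1 are diagonal entries of a conjugate of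
    (S + E)^2 - 1 = S E + E S + E^2 and so are of order E.  The number of negative
    eigenvalues is locally constant because it is an affine function of the trace
    of the sign, which is close to the trace of S. *)
Lemma sign_near_involution d k (S : 'M[R]_d) :
  S^T = S -> S *m S = 1%:M -> \tr S = d%:R - 2 * k%:R ->
  exists K r : R, [/\ 0 < K, 0 < r & forall (V : 'M[R]_d) (s : 'rV[R]_d),
    V^T *m V = 1%:M -> let E := V *m diag_mx s *m V^T - S in `|E| <= r ->
    [/\ forall i, s 0 i != 0, #|[pred i | s 0 i < 0]| = k
      & `|V *m diag_mx (\row_i Num.sg (s 0 i)) *m V^T - S
          - 2^-1 *: (E - S *m E *m S)| <= K * `|E| ^+ 2]].
Proof.
move=> St SS trS; pose D : R := d%:R; have D0 : 0 <= D by [].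
have S1 : `|S| <= 1 by apply: orthogonal_norm_le1; rewrite St.
pose c := 3 * D ^+ 3; have c0 : 0 <= c by rewrite mulr_ge0 // exprn_ge0.
pose K := 1 + D ^+ 2 * c ^+ 2 + 2 * D ^+ 2.
have K0 : 0 < K.
  by rewrite /K -addrA ltr_wpDr // addr_ge0 // mulr_ge0 // exprn_ge0.
(* The radius is 1 / m: the summand 2 c keeps the eigenvalues away from 0, and
   the last summand makes the traces differ by less than 2. *)
pose m := 1 + 2 * c + D * (K + 1 + D ^+ 2).
have K1 : 0 <= K + 1 + D ^+ 2.
  by apply: addr_ge0 (addr_ge0 (ltW K0) ler01) (exprn_ge0 _ D0).
have m1 : 1 <= m.
  by rewrite /m -addrA lerDl; apply: addr_ge0; apply: mulr_ge0.
have m0 : 0 < m by apply: lt_le_trans m1.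
exists K, m^-1; split=> //; first by rewrite invr_gt0.
move=> V s VV E Er; set A := V *m diag_mx s *m V^T in E Er *.
have AE : A = S + E by rewrite /E addrC subrK.
set e := `|E| in Er *; have e0 : 0 <= e by exact: normr_ge0.
have me : m * e <= 1 by rewrite -ler_pdivlMl // mulr1.
have e1 : e <= 1 by apply: le_trans Er _; rewrite invf_le1.
have V1 := orthogonal_norm_le1 VV.
have Vt1 : `|V^T| <= 1 by rewrite trmx_norm.
have bnd := @mul3mx_norm_le d; rewrite -/D in bnd.
have AAE : A *m A - 1%:M = S *m E + E *m S + E *m E.
  rewrite AE mulmxDl !mulmxDr SS.
  move: (S *m E) (E *m S) (E *m E) => X Y Z.
  by apply/matrixP => i j; rewrite !mxE; ring.
have G : `|A *m A - 1%:M| <= 3 * D * e.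
  rewrite AAE (le_trans (ler_normD _ _)) //.
  rewrite (le_trans (lerD (ler_normD _ _) (lexx _))) //.
  have h1 := mulmx_norm_le S E; have h2 := mulmx_norm_le E S.
  have h3 := mulmx_norm_le E E; rewrite -/D -/e in h1 h2 h3.
  have : D * `|S| * e <= D * e.
    by rewrite mulrAC ler_piMr // mulr_ge0.
  have : D * e * e <= D * e by rewrite ler_piMr // mulr_ge0.
  have : D * e * `|S| <= D * e by rewrite ler_piMr // mulr_ge0.
  lra.
have sq i : `|s 0 i ^+ 2 - 1| <= c * e.
  have -> : s 0 i ^+ 2 - 1 = (V^T *m (A *m A - 1%:M) *m V) i i.
    rewrite mulmxBr mulmxBl mulmx1 VV /A conj_diag_mul // !mulmxA VV mul1mx.
    by rewrite -mulmxA VV mulmx1 !mxE eqxx mulr1n expr2.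
  apply: le_trans (mx_entry_le _ _ _) _.
  apply: le_trans (bnd _ _ _ _ _ _ Vt1 G V1) _.
  by rewrite mul1r mulr1 /c le_eqVlt; apply/orP; left; apply/eqP; ring.
have ce : c * e <= 2^-1.
  have : 2 * c * e <= m * e.
    rewrite ler_wpM2r // /m addrAC lerDr; apply: addr_ge0 => //.
    exact: mulr_ge0.
  lra.
have s0 i : s 0 i != 0.
  apply/eqP => s0; have := sq i; rewrite s0 expr0n /= sub0r normrN normr1.
  by lra.
set C := V *m diag_mx _ *m V^T.
have est : `|C - S - 2^-1 *: (E - S *m E *m S)| <= K * e ^+ 2.
  pose N := 2^-1 *: (3 *: A - A *m A *m A).
  have -> : C - S - 2^-1 *: (E - S *m E *m S) =
      (C - N) + (N - S - 2^-1 *: (E - S *m E *m S)).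
    by rewrite !addrA subrK.
  apply: le_trans (ler_normD _ _) _.
  have NE : N = V *m diag_mx (\row_i (2^-1 * (3 * s 0 i - s 0 i ^+ 3))) *m V^T.
    rewrite /N /A !conj_diag_mul // !conj_diag_scale conj_diag_diff.
    rewrite conj_diag_scale; congr (_ *m diag_mx _ *m _).
    by apply/rowP => i; rewrite !mxE; ring.
  have CN : `|C - N| <= D ^+ 2 * (c * e) ^+ 2.
    rewrite NE /C conj_diag_diff.
    have := bnd V _ V^T 1 ((c * e) ^+ 2) 1; rewrite mul1r mulr1; apply=> //.
    apply: diag_mx_norm_le => [|i]; first exact: sqr_ge0.
    rewrite !mxE (le_trans (sg_cubic_bound _)) //.
    by rewrite -real_normK ?num_real // lerXn2r ?nnegrE // mulr_ge0.
  have Nrest : `|N - S - 2^-1 *: (E - S *m E *m S)| <= 2 * D ^+ 2 * e ^+ 2.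
    rewrite /N AE newton_schulz_expand // scaleNr normrN normrZ gtr0_norm //.
    rewrite ler_pdivrMl //.
    have b1 := bnd S E E _ _ _ S1 (lexx _) (lexx _).
    have b2 := bnd E S E _ _ _ (lexx _) S1 (lexx _).
    have b3 := bnd E E S _ _ _ (lexx _) (lexx _) S1.
    have b4 := bnd E E E _ _ _ (lexx _) (lexx _) e1.
    rewrite (le_trans (ler_normD _ _)) // (le_trans (lerD (ler_normD _ _) (lexx _))) //.
    rewrite (le_trans (lerD (lerD (ler_normD _ _) (lexx _)) (lexx _))) //.
    apply: le_trans (lerD (lerD (lerD b1 b2) b3) b4) _; rewrite -/e.
    by rewrite le_eqVlt; apply/orP; left; apply/eqP; ring.
  apply: le_trans (lerD CN Nrest) _; rewrite /K.
  by have := sqr_ge0 e; nra.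
split=> //.
have : `|(d%:R - 2 * #|[pred i | s 0 i < 0]|%:R) - (d%:R - 2 * k%:R)| < 2 :> R.
  rewrite -sum_sg // -trS.
  have -> : \sum_i Num.sg (s 0 i) = \tr C.
    rewrite /C mxtrace_mulC mulmxA VV mul1mx mxtrace_diag.
    by apply: eq_bigr => i _; rewrite mxE.
  rewrite -raddfB /= (le_lt_trans (mxtrace_norm_le _)) // -/D.
  have CS : `|C - S| <= (K + 1 + D ^+ 2) * e.
    pose Y := 2^-1 *: (E - S *m E *m S).
    have -> : C - S = (C - S - Y) + Y by rewrite subrK.
    rewrite (le_trans (ler_normD _ _)) // normrZ gtr0_norm //.
    have h1 : `|E - S *m E *m S| <= e + D ^+ 2 * e.
      rewrite (le_trans (ler_normB _ _)) // lerD2l.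
      by rewrite -[e in leRHS]mul1r -[1 * e]mulr1 bnd.
    have h2 : K * e ^+ 2 <= K * e by rewrite ler_wpM2l ?(ltW K0) // expr2 ler_piMr.
    have h3 : 0 <= D ^+ 2 * e by rewrite mulr_ge0 // exprn_ge0.
    by have := lerD est (lexx (2^-1 * (e + D ^+ 2 * e))); lra.
  apply: le_lt_trans (_ : m * e < 2); last by apply: le_lt_trans me _; rewrite ltr1n.
  apply: le_trans (ler_wpM2l D0 CS) _; rewrite mulrA ler_wpM2r //.
  by rewrite /m lerDr addr_ge0 // mulr_ge0.
set p := #|_|.
have -> : d%:R - 2 * p%:R - (d%:R - 2 * k%:R) = 2 * (k%:R - p%:R) :> R by ring.
rewrite normrM gtr0_norm // -[ltRHS]mulr1 ltr_pM2l // => pk.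
case: (ltngtP p k) pk => // h; rewrite ltNge.
- by rewrite ger0_norm ?subr_ge0 ?ler_nat ?(ltnW h) // lerBrDr nat1r ler_nat h.
- rewrite distrC ger0_norm ?subr_ge0 ?ler_nat ?(ltnW h) //.
  by rewrite lerBrDr nat1r ler_nat h.
Qed.

End MaxNorm.

(** * Differentiability of Orth at an involution *)

Section OrthNear.
Context {R : realType}.

Lemma sorted_neg_initial d k (s : 'rV[R]_d) :
  (forall i j : 'I_d, (i <= j)%N -> s 0 i <= s 0 j) ->
  #|[pred i | s 0 i < 0]| = k -> forall i : 'I_d, (s 0 i < 0) = (i < k)%N.
Proof.
move=> smono <- i; have card_lt m : (m <= d)%N -> #|[pred j : 'I_d | (j < m)%N]| = m.
  move=> md; rewrite -sum1_card (eq_bigl (fun j : 'I_d => (j < m)%N)) //.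
  by rewrite (big_ord_narrow md) sum1_card card_ord.
apply/idP/idP => [si|].
  rewrite -[X in (X <= _)%N](card_lt i.+1 (ltn_ord i)).
  apply: subset_leq_card; apply/fintype.subsetP => j; rewrite !inE ltnS => ji.
  exact: le_lt_trans (smono _ _ ji) si.
apply: contraLR; rewrite -leNgt -leqNgt => si.
rewrite -[X in (_ <= X)%N](card_lt i (ltnW (ltn_ord i))).
apply: subset_leq_card; apply/fintype.subsetP => j; rewrite !inE => sj.
by rewrite ltnNge; apply/negP => /smono ij; have := lt_le_trans sj si;
  rewrite ltNge ij.
Qed.

Lemma conj_diag_sym d (V : 'M[R]_d) (s : 'rV[R]_d) :
  (V *m diag_mx s *m V^T)^T = V *m diag_mx s *m V^T.
Proof. by rewrite !trmx_mul trmxK tr_diag_mx mulmxA. Qed.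

Lemma vsproj_sym d (A : 'M[R]_d) : A^T = A -> vsval (vsproj (symv R d) A) = A.
Proof. by move=> At; rewrite vsprojK // mem_symv At. Qed.

Lemma Sym_trmx d (S : Sym R d) : (vsval S)^T = vsval S.
Proof. by apply/eqP; rewrite -mem_symv; exact: subvsP. Qed.

Lemma Orth_spec d k (A : 'M[R]_d) : in_Orth_domain k A -> is_orth k A (vsval (Orth k A)).
Proof.
move=> [B AB]; apply: (@xgetPex _ 0 [set B : Sym R d | is_orth k A (vsval B)]).
exists (vsproj (symv R d) B); rewrite /= vsproj_sym //.
by have [V [s [_ _ _ _ ->]]] := AB; rewrite conj_diag_sym.
Qed.

(** For existence, the sorted eigendecomposition qualifies: by the count of
    negative eigenvalues there is a gap at k.  The estimate holds for every
    admissible decomposition, so it holds for the value that [Orth] selects. *)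
Lemma Orth_near_involution d k (S : 'M[R]_d) :
  S^T = S -> S *m S = 1%:M -> \tr S = d%:R - 2 * k%:R ->
  exists K r : R, [/\ 0 < K, 0 < r & forall A : 'M[R]_d, A^T = A ->
    let E := A - S in `|E| <= r -> in_Orth_domain k A /\
      `|vsval (Orth k A) - S - 2^-1 *: (E - S *m E *m S)| <= K * `|E| ^+ 2].
Proof.
move=> St SS trS; have [K [r [K0 r0 near]]] := sign_near_involution St SS trS.
exists K, r; split=> // A symA E Er.
have sgE (s : 'rV[R]_d) : (forall i, s 0 i != 0) ->
    #|[pred i | s 0 i < 0]| = k ->
    (forall i j : 'I_d, (i <= j)%N -> s 0 i <= s 0 j) ->
    \row_i (if (i < k)%N then -1 else 1) = \row_i Num.sg (s 0 i).
  move=> s0 sk smono; apply/rowP => i; rewrite !mxE.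
  rewrite -(sorted_neg_initial smono sk); case: ifP => si.
    by rewrite ltr0_sg.
  by rewrite gtr0_sg // lt_def s0 leNgt si.
have domA : in_Orth_domain k A.
  have [l lsort lA] := symmetric_sorted_roots symA.
  have [V VV AV] := diagonalization_by_roots symA lA.
  set s := \row_i _ in AV.
  have := near V s VV; rewrite -AV => /(_ Er) [s0 sk _].
  have smono (i j : 'I_d) : (i <= j)%N -> s 0 i <= s 0 j.
    move=> ij; rewrite !mxE !(tnth_nth 0).
    by apply: (sorted_leq_nth le_trans lexx) => //; rewrite inE size_tuple.
  exists (V *m diag_mx (\row_(i < d) if (i < k)%N then -1 else 1) *m V^T).
  exists V, s; split=> // i j /andP[ik kj].
  apply: (@lt_le_trans _ _ 0).
    by rewrite (sorted_neg_initial smono sk).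
  by rewrite leNgt (sorted_neg_initial smono sk) -leqNgt.
split=> //; have [V [s [VV AV smono _ ->]]] := Orth_spec domA.
have := near V s VV; rewrite -AV => /(_ Er) [s0 sk].
by rewrite -(sgE s).
Qed.

End OrthNear.

(** * Tools for Frechet derivatives *)

Section Frechet.
Context {R : realType}.

Lemma is_diff_near (V W : normedModType R) (f df : V -> W) x : is_diff x f df ->
  forall e, 0 < e -> \forall h \near (0 : V), `|f (h + x) - f x - df h| <= e * `|h|.
Proof.
move=> fd e e0; have [_ /eqaddoP/(_ e e0)] := (diff_locallyP _ _).1 (@ex_diff _ _ _ _ _ _ _ fd).
rewrite (@diff_val _ _ _ _ _ _ _ fd).
by apply: filterS => h; rewrite /= opprD addrA.
Qed.

Lemma is_diff_eps (V W : normedModType R) (f : V -> W) (df : {linear V -> W}) x :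
  continuous df ->
  (forall e, 0 < e -> \forall h \near (0 : V), `|f (h + x) - f x - df h| <= e * `|h|) ->
  is_diff x f df.
Proof.
move=> dfc dff.
have dE : f \o shift x = cst (f x) + df +o_ (0 : V) id.
  apply/eqaddoP => e /dff; apply: filterS => h.
  by rewrite [(_ - _) h]/= opprD addrA.
have dfE := diff_unique dfc dE.
by apply: DiffDef => //; apply/diff_locallyP; rewrite dfE.
Qed.

Lemma lipschitz_linear_continuous (V W : normedModType R) (f : {linear V -> W}) C :
  (forall x, `|f x| <= C * `|x|) -> continuous f.
Proof.
move=> fC x; apply/cvgrPdist_le => e e0.
pose C' := `|C| + 1; have C'0 : 0 < C' by rewrite ltr_wpDl.
near=> y; rewrite -linearB (le_trans (fC _)) //.
apply: le_trans (_ : C' * `|x - y| <= _).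
  by rewrite ler_wpM2r // (le_trans (ler_norm C)) // lerDl.
rewrite -ler_pdivlMl //; near: y; apply: cvgr_dist_le => //.
by rewrite mulr_gt0 // invr_gt0.
Unshelve. all: by end_near. Qed.

Lemma is_diff_mx (V : normedModType R) m n (F : V -> 'M[R]_(m, n))
    (dF : 'I_m -> 'I_n -> V -> R) x :
  (forall i j, is_diff x (fun y => F y i j) (dF i j)) ->
  is_diff x F (fun h => \matrix_(i, j) dF i j h).
Proof.
move=> Fd; pose L h := \matrix_(i, j) 'd (fun y => F y i j) x h.
have LE : (fun h => \matrix_(i, j) dF i j h) = L.
  apply/funext => h; apply/matrixP => i j; rewrite !mxE.
  by rewrite (@diff_val _ _ _ _ _ _ _ (Fd i j)).
have lin : linear L.
  by move=> a u v; apply/matrixP => i j; rewrite !mxE linearP.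
pose LL : {linear V -> 'M[R]_(m, n)} :=
  HB.pack L (GRing.isLinear.Build _ _ _ _ L lin).
rewrite LE -[L]/(LL : _ -> _); apply: is_diff_eps.
  have /choice[C CP] : forall ij : 'I_m * 'I_n, exists c : R, forall h,
      0 <= c /\ `|'d (fun y => F y ij.1 ij.2) x h| <= c * `|h|.
    move=> [i j] /=.
    have [] := @linear_lipschitz _ _ _ ('d (fun y => F y i j) x).
      by apply: diff_continuous; apply: ex_diff.
    by move=> c c0 cP; exists c => h; split; [exact: ltW | exact: cP].
  apply: (@lipschitz_linear_continuous _ _ _ (\sum_ij C ij)) => h.
  have C0 ij : 0 <= C ij by have [] := CP ij 0.
  apply: mx_norm_le => [|i j]; first by rewrite mulr_ge0 // sumr_ge0.
  rewrite mxE; have [_ /= /le_trans] := CP (i, j) h; apply.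
  by rewrite ler_wpM2r // (bigD1 (i, j)) //= lerDl sumr_ge0.
move=> e e0.
have : \forall h \near (0 : V), forall ij : 'I_m * 'I_n,
    `|F (h + x) ij.1 ij.2 - F x ij.1 ij.2 - dF ij.1 ij.2 h| <= e * `|h|.
  by apply: filter_forall => -[i j]; exact: is_diff_near.
apply: filterS => h Fh; apply: mx_norm_le => [|i j].
  by rewrite mulr_ge0 // ltW.
rewrite /= -LE; have := Fh (i, j); congr (`|_| <= _); by rewrite !mxE.
Qed.

Lemma is_diff_mulmx_pair m n p (q : 'M[R]_(m, n) * 'M[R]_(n, p)) :
  is_diff q (fun r => r.1 *m r.2) (fun r => q.1 *m r.2 + r.1 *m q.2).
Proof.
set L := (X in is_diff _ _ X).
have lin : linear L.
  move=> a u v; rewrite /L /= mulmxDr mulmxDl -scalemxAr -scalemxAl scalerDr.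
  by rewrite addrACA.
pose LL : {linear ('M[R]_(m, n) * 'M[R]_(n, p))%type -> 'M[R]_(m, p)} :=
  HB.pack L (GRing.isLinear.Build _ _ _ _ L lin).
have n1 (r : 'M[R]_(m, n) * 'M[R]_(n, p)) : `|r.1| <= `|r|.
  by rewrite prod_normE le_max lexx.
have n2 (r : 'M[R]_(m, n) * 'M[R]_(n, p)) : `|r.2| <= `|r|.
  by rewrite prod_normE le_max lexx orbT.
rewrite -[L]/(LL : _ -> _); apply: is_diff_eps.
  apply: (@lipschitz_linear_continuous _ _ _ (n%:R * `|q| + n%:R * `|q|)) => h.
  apply: le_trans (ler_normD _ _) _; rewrite mulrDl lerD //.
    apply: le_trans (mulmx_norm_le _ _) _.
    by rewrite -!mulrA ler_wpM2l // ler_pM.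
  apply: le_trans (mulmx_norm_le _ _) _.
  by rewrite mulrAC -!mulrA ler_wpM2l // ler_pM.
move=> e e0; near=> h.
have -> : (h + q).1 *m (h + q).2 - q.1 *m q.2 - LL h = h.1 *m h.2.
  rewrite /= /L mulmxDl !mulmxDr.
  move: (h.1 *m h.2) (h.1 *m q.2) (q.1 *m h.2) (q.1 *m q.2) => *.
  by apply/matrixP => i j; rewrite !mxE; ring.
apply: le_trans (mulmx_norm_le _ _) _.
apply: ler_pM => //.
apply: le_trans (_ : (n%:R + 1) * `|h| <= _).
  by apply: ler_pM => //; rewrite lerDl.
have n0 : 0 < n%:R + 1 :> R by rewrite ltr_wpDl.
rewrite -ler_pdivlMl // -[h]subr0 distrC; near: h.
by apply: cvgr_dist_le => //; rewrite mulr_gt0 // invr_gt0.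
Unshelve. all: by end_near. Qed.

Lemma is_diff_mulmx (V : normedModType R) m n p (F dF : V -> 'M[R]_(m, n))
    (G dG : V -> 'M[R]_(n, p)) x :
  is_diff x F dF -> is_diff x G dG ->
  is_diff x (fun y => F y *m G y) (fun h => F x *m dG h + dF h *m G x).
Proof.
move=> Fd Gd.
exact: (@is_diff_comp _ _ _ _ (fun y => (F y, G y)) (fun h => (dF h, dG h))
  (fun r => r.1 *m r.2) _ x (is_diff_pair Fd Gd) (is_diff_mulmx_pair _)).
Qed.

End Frechet.

(** * Derivatives of the gradient and the Hessian *)

Section Schwarz.
Context {R : realType} {d : nat}.
Implicit Types (f : 'cV[R]_d -> R).

Lemma is_derive_line f (x u : 'cV[R]_d) (t : R) : differentiable f (x + t *: u) ->
  is_derive t 1 (fun s : R => f (x + s *: u)) ('D_u f (x + t *: u)).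
Proof.
move=> fd; set g := fun s : R => f (x + s *: u).
have E : (fun h : R => h^-1 *: ((g \o shift t) (h *: 1) - g t)) =
    (fun h => h^-1 *: ((f \o shift (x + t *: u)) (h *: u) - f (x + t *: u))).
  apply/funext => h /=; rewrite /g [h *: 1]mulr1 scalerDl.
  by rewrite [x + (_ + _)]addrCA.
have fu : derivable f (x + t *: u) u by exact: diff_derivable.
by split; rewrite /derivable /derive E.
Qed.

Lemma is_C_differentiable n f : is_C n.+1 f -> forall x, differentiable f x.
Proof. by case. Qed.

Lemma is_C_partial n f i : is_C n.+1 f -> is_C n (partial i f).
Proof. by move=> [_ ]; apply. Qed.

Lemma is_C_continuous n f : is_C n f -> continuous f.
Proof.
case: n => // n /is_C_differentiable fd x.
exact: differentiable_continuous.
Qed.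

Lemma is_C_pred n f : is_C n.+1 f -> is_C n f.
Proof.
elim: n f => [|n IH] f fC; first exact: is_C_continuous fC.
by split=> [|i]; [exact: is_C_differentiable fC | apply/IH/is_C_partial].
Qed.

Lemma mean_value_line f (x u : 'cV[R]_d) (h : R) : 0 < h ->
  (forall y, differentiable f y) ->
  exists2 t, 0 <= t <= h & f (x + h *: u) - f x = h * 'D_u f (x + t *: u).
Proof.
move=> h0 fd; pose g (s : R) := f (x + s *: u).
have gd (t : R) : is_derive t 1 g ('D_u f (x + t *: u)) by exact: is_derive_line.
have [|c] := MVT h0 (fun t _ => gd t).
  apply: derivable_within_continuous => t _.
  by have [] := gd t.
rewrite in_itv /= => /andP[c0 ch]; rewrite /g scale0r addr0 subr0 => ->.
by exists c; [rewrite !ltW | rewrite mulrC].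
Qed.

(** The mean value theorem is applied to y |-> f (y + h e_j) - f y along e_i, and
    then to the partial derivative of f along e_j.  The second difference is
    symmetric in i and j, which is what makes mixed partials agree. *)
Lemma second_difference f (i j : 'I_d) x (h : R) : 0 < h -> is_C 2 f ->
  exists2 p, `|p - x| <= 2 * h &
    f (x + h *: delta_mx i 0 + h *: delta_mx j 0) - f (x + h *: delta_mx i 0)
      - f (x + h *: delta_mx j 0) + f x = h ^+ 2 * partial j (partial i f) p.
Proof.
move=> h0 fC; set ei : 'cV[R]_d := delta_mx i 0; set ej : 'cV[R]_d := delta_mx j 0.
have fd := is_C_differentiable fC.
have fid := is_C_differentiable (is_C_partial i fC).
pose g y := f (y + h *: ej) - f y.
have shd y : is_diff y (fun z => f (z + h *: ej)) ('d f (y + h *: ej)).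
  have := @is_diff_comp _ _ _ _ (fun z => z + h *: ej) _ f _ y
    (is_diffD (is_diff_id y) (is_diff_cst (h *: ej) y)) (differentiableP (fd (y + h *: ej))).
  by move/is_diff_eq; apply; apply/funext => z /=; rewrite addr0.
have gdf y : is_diff y g (('d f (y + h *: ej) : 'cV[R]_d -> R) - ('d f y : 'cV[R]_d -> R)).
  exact: is_diffB (shd y) (differentiableP (fd y)).
have gd y : differentiable g y by apply: ex_diff.
have [t /andP[t0 th] gt] := mean_value_line x ei h0 gd.
have gD y : 'D_ei g y = partial i f (y + h *: ej) - partial i f y.
  by rewrite deriveE // diff_val /partial !deriveE.
have [s /andP[s0 sh]] := mean_value_line (x + t *: ei) ej h0 fid.
rewrite -gD => gs; exists (x + t *: ei + s *: ej).
  rewrite -[x + _ + _]addrA [x + (_ + _)]addrC addrK (le_trans (ler_normD _ _)) // !normrZ.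
  have e1 l : `|delta_mx l 0 : 'cV[R]_d| <= 1.
    by apply: mx_norm_le => // a b; rewrite mxE; case: (_ && _); rewrite ?normr1 ?normr0.
  rewrite mulr_natl mulr2n; apply: lerD; rewrite ger0_norm //.
    by rewrite -[leRHS]mulr1; apply: ler_pM => //; exact: e1.
  by rewrite -[leRHS]mulr1; apply: ler_pM => //; exact: e1.
rewrite expr2 -mulrA -gs -gt /g opprB addrA; ring.
Qed.

(** The common second difference equals h^2 times either mixed partial at two
    points within 2 h of x; continuity of both concludes. *)
Lemma partial_comm f (i j : 'I_d) x : is_C 2 f ->
  partial i (partial j f) x = partial j (partial i f) x.
Proof.
move=> fC; apply/eqP; rewrite -subr_eq0 -normr_le0; apply/ler_addgt0Pl => e e0.
have cij a b := is_C_continuous (is_C_partial a (is_C_partial b fC)).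
have e2 : 0 < e / 2 by rewrite divr_gt0.
have near a b : \forall y \near x, `|partial a (partial b f) x - partial a (partial b f) y| <= e / 2.
  by have /cvgrPdist_le := cij a b x; apply.
have : \forall y \near x,
    `|partial i (partial j f) x - partial i (partial j f) y| <= e / 2 /\
    `|partial j (partial i f) x - partial j (partial i f) y| <= e / 2.
  by apply: filterI; apply: near.
move=> /nbhs_normP[r /= r0 rP].
pose h := r / 4; have h0 : 0 < h by rewrite divr_gt0.
have inr (p : 'cV[R]_d) : `|p - x| <= 2 * h -> ball_ Num.Def.normr x r p.
  by rewrite /ball_ /= distrC => /le_lt_trans; apply; rewrite /h; lra.
have [p /inr/rP[_ pP] pE] := second_difference i j x h0 fC.
have [q /inr/rP[qP _] qE] := second_difference j i x h0 fC.
(* Both second differences are the same combination of four values of f. *)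
have pq : partial j (partial i f) p = partial i (partial j f) q.
  apply: (mulfI (_ : h ^+ 2 != 0)); first by rewrite expf_neq0 // gt_eqF.
  apply: etrans (esym pE) _; apply: etrans _ qE.
  have xij : x + h *: delta_mx j 0 + h *: delta_mx i 0 =
      x + h *: delta_mx i 0 + h *: delta_mx j 0 by rewrite addrAC.
  rewrite xij.
  move: (f _) (f (x + h *: delta_mx i 0)) (f (x + h *: delta_mx j 0)) (f x).
  by move=> A B C D; ring.
rewrite addr0.
move: pq qP pP.
move: (partial j (partial i f) p) (partial i (partial j f) q).
move: (partial i (partial j f) x) (partial j (partial i f) x) => A B P Q -> AQ BQ.
have -> : A - B = (A - Q) - (B - Q) by ring.
by rewrite (le_trans (ler_normB _ _)) // [leRHS]splitr lerD.
Qed.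

Lemma differential_partials f (x u : 'cV[R]_d) : differentiable f x ->
  'd f x u = \sum_i u i 0 * partial i f x.
Proof.
move=> fd; have uE : u = \sum_i u i 0 *: delta_mx i 0.
  rewrite [LHS]matrix_sum_delta; apply: eq_bigr => i _.
  by rewrite big_ord1.
rewrite [in LHS]uE linear_sum; apply: eq_bigr => i _.
by rewrite linearZ /partial deriveE.
Qed.

Lemma hessian_sym f x : is_C 2 f -> (hessian f x)^T = hessian f x.
Proof. by move=> fC; apply/matrixP => i j; rewrite !mxE partial_comm. Qed.

(** The differential naturally comes with the transpose of the Hessian; symmetry
    removes it. *)
Lemma is_diff_gradient f x : is_C 2 f ->
  is_diff x (gradient f) (fun u => hessian f x *m u).
Proof.
move=> fC.
have fid i := is_C_differentiable (is_C_partial i fC).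
have gd (i : 'I_d) (j : 'I_1) :
    is_diff x (fun y => gradient f y i j) ('d (partial i f) x).
  rewrite (_ : (fun y => _) = partial i f); last by apply/funext => y; rewrite mxE.
  exact: differentiableP.
apply: is_diff_eq (is_diff_mx gd) _; apply/funext => u.
apply/matrixP => i j; rewrite !mxE differential_partials // ord1.
by apply: eq_bigr => l _; rewrite mxE mulrC partial_comm.
Qed.

Lemma is_diff_hessian f x : is_C 3 f -> exists2 dH : {linear 'cV[R]_d -> 'M[R]_d},
  is_diff x (hessian f) dH & continuous dH /\ forall u, (dH u)^T = dH u.
Proof.
move=> fC.
have fijd i j := is_C_differentiable (is_C_partial i (is_C_partial j fC)).
have hd (i j : 'I_d) :
    is_diff x (fun y => hessian f y i j) ('d (partial i (partial j f)) x).
  rewrite (_ : (fun y => _) = partial i (partial j f)).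
    exact: differentiableP.
  by apply/funext => y; rewrite mxE.
have Hd := is_diff_mx hd.
have Hd' : differentiable (hessian f) x by exact: ex_diff.
exists ('d (hessian f) x); first exact: differentiableP.
split=> [|u]; first exact: diff_continuous.
have pC i j : partial i (partial j f) = partial j (partial i f).
  by apply/funext => y; apply: partial_comm; exact: is_C_pred.
by rewrite (@diff_val _ _ _ _ _ _ _ Hd); apply/matrixP => i j; rewrite !mxE pC.
Qed.

End Schwarz.

(** * Norms contracted by the derivative *)

Section Contraction.
Context {R : realType}.

(** Near the fixed point the remainder of the linearization is absorbed in half
    of the contraction gap 1 - rho, so the nonlinear map also contracts N, on a
    ball that the orbit cannot leave. *)
Lemma adapted_norm_linear_stability (E : normedModType R) (N : E -> R) (c C rho : R)
    (Phi J : E -> E) (z : E) :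
  (forall x y, N (x + y) <= N x + N y) ->
  0 < c -> (forall x, c * `|x| <= N x) ->
  0 < C -> (forall x, N x <= C * `|x|) ->
  rho < 1 -> 0 <= rho -> (forall x, N (J x) <= rho * N x) ->
  Phi z = z -> is_diff z Phi J ->
  exists C' rho' : R, 0 <= rho' < 1 /\
    \forall w \near z, forall n : nat,
      `|iter n Phi w - z| <= C' * rho' ^+ n * `|w - z|.
Proof.
move=> ND c0 cN C0 CN rho1 rho0 NJ Pz PJ.
(* q is the midpoint of rho and 1; e is chosen so that C e / c, the cost of the
   remainder measured in N, is (1 - rho) / 2. *)
pose q := (1 + rho) / 2; exists (C / c), q; split.
  by apply/andP; split; rewrite /q; lra.
have q0 : 0 <= q by rewrite /q; lra.
have q1 : q <= 1 by rewrite /q; lra.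
pose e := c * (1 - rho) / (2 * C).
have e0 : 0 < e by rewrite /e divr_gt0 ?mulr_gt0 ?subr_gt0.
have /nbhs_normP[r /= r0 rP] := is_diff_near PJ e0.
have contr w : `|w - z| < r -> N (Phi w - z) <= q * N (w - z).
  move=> wr; have := rP (w - z); rewrite /ball_ /= sub0r normrN => /(_ wr).
  rewrite subrK Pz => est.
  have -> : Phi w - z = J (w - z) + (Phi w - z - J (w - z)) by rewrite [RHS]addrC subrK.
  apply: le_trans (ND _ _) _; apply: le_trans (lerD (NJ _) (CN _)) _.
  have h1 : C * `|Phi w - z - J (w - z)| <= (1 - rho) / 2 * (c * `|w - z|).
    apply: le_trans (ler_wpM2l (ltW C0) est) _.
    rewrite le_eqVlt; apply/orP; left; apply/eqP; rewrite /e.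
    by field; rewrite gt_eqF.
  have h2 : (1 - rho) / 2 * (c * `|w - z|) <= (1 - rho) / 2 * N (w - z).
    by apply: ler_wpM2l (cN _); lra.
  by rewrite /q; lra.
(* Within this radius N (w - z) < c r, and N < c r forces the norm below r. *)
apply/nbhs_normP; exists (c * r / C) => /=; first by rewrite divr_gt0 ?mulr_gt0.
move=> w; rewrite /ball_ /= distrC => wr n.
have Nw : N (w - z) < c * r.
  by apply: le_lt_trans (CN _) _; rewrite mulrC -ltr_pdivlMr.
have Nw0 : 0 <= N (w - z) by apply: le_trans (cN _); rewrite mulr_ge0 // ltW.
have iterN : N (iter n Phi w - z) <= q ^+ n * N (w - z).
  elim: n => [|n IH]; first by rewrite expr0 mul1r.
  rewrite iterS exprS -mulrA; apply: le_trans (contr _ _) _.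
    rewrite -(ltr_pM2l c0); apply: le_lt_trans (cN _) _.
    apply: le_lt_trans IH (le_lt_trans _ Nw).
    by rewrite ler_piMl // exprn_ile1.
  by rewrite ler_wpM2l.
rewrite -(ler_pM2l c0); apply: le_trans (cN _) _; apply: le_trans iterN _.
apply: le_trans (ler_wpM2l (exprn_ge0 _ q0) (CN _)) _.
rewrite le_eqVlt; apply/orP; left; apply/eqP.
by field; rewrite gt_eqF.
Qed.

Lemma growth_rate_le (a b q K : R) : 0 < a -> 0 <= q ->
  (forall n, b ^+ n * a <= K * q ^+ n) -> b <= q.
Proof.
move=> a0 q0 bq; rewrite leNgt; apply/negP => qb.
have b0 : 0 < b by apply: le_lt_trans qb.
have : forall n, a <= K * (q / b) ^+ n.
  move=> n; rewrite exprMn exprVn mulrA ler_pdivlMr ?exprn_gt0 //.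
  by rewrite mulrC bq.
have qb1 : `|q / b| < 1.
  by rewrite ger0_norm ?divr_ge0 ?(ltW b0) // ltr_pdivrMr // mul1r.
have K1 : 0 < `|K| + 1 by rewrite ltr_wpDl.
have /cvgrPdist_lt/(_ (a / (`|K| + 1))) := cvg_expr qb1.
rewrite divr_gt0 // => /(_ isT)/filter_ex[n]; rewrite sub0r normrN => small aK.
have := aK n; rewrite leNgt => /negP; apply; apply: le_lt_trans (ler_norm _) _.
rewrite normrM; apply: le_lt_trans (_ : (`|K| + 1) * `|(q / b) ^+ n| < _).
  by apply: ler_wpM2r => //; rewrite lerDl.
by rewrite mulrC -ltr_pdivlMr.
Qed.

(** Together with the next lemma: a real matrix acts separately on the real and
    imaginary parts of a complex row vector. *)
Lemma Re_mulmx n (w : 'rV[R[i]]_n) (M : 'M[R]_n) :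
  map_mx (@complex.Re R) (w *m map_mx (real_complex R) M) =
  map_mx (@complex.Re R) w *m M.
Proof.
have ReD : {morph @complex.Re R : x y / x + y} by move=> [a b] [a' b'].
apply/rowP => j; rewrite !mxE (big_morph _ ReD (erefl : complex.Re 0 = 0)).
apply: eq_bigr => i _; rewrite !mxE.
by case: (w 0 i) => a b /=; rewrite mulr0 subr0.
Qed.

Lemma Im_mulmx n (w : 'rV[R[i]]_n) (M : 'M[R]_n) :
  map_mx (@complex.Im R) (w *m map_mx (real_complex R) M) =
  map_mx (@complex.Im R) w *m M.
Proof.
have ImD : {morph @complex.Im R : x y / x + y} by move=> [a b] [a' b'].
apply/rowP => j; rewrite !mxE (big_morph _ ImD (erefl : complex.Im 0 = 0)).
apply: eq_bigr => i _; rewrite !mxE.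
by case: (w 0 i) => a b /=; rewrite mulr0 add0r.
Qed.

Lemma normc_le_ReIm (z : R[i]) :
  ComplexField.Normc.normc z <= `|complex.Re z| + `|complex.Im z|.
Proof.
case: z => x y /=.
have -> : `|x| + `|y| = Num.sqrt ((`|x| + `|y|) ^+ 2).
  by rewrite sqrtr_sqr [RHS]ger0_norm // addr_ge0.
apply: ler_wsqrtr; rewrite -[x ^+ 2]real_normK ?num_real //.
rewrite -[y ^+ 2]real_normK ?num_real // sqrrD addrAC lerDl.
by rewrite mulrn_wge0 // mulr_ge0.
Qed.

(** The coordinates of phi^n h are bounded by a multiple of rho^n.  For a complex
    eigenvector w with eigenvalue z, applying this to its real and imaginary
    parts bounds z^n w, hence |z| <= rho by comparison of growth rates. *)
Lemma spectral_radius_le (E : vectType R) (b : (\dim {: E}).-tuple E) (phi : 'End(E))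
    (N : E -> R) (rho C : R) :
  basis_of {: E} b -> 0 <= rho ->
  (forall h j, `|passmx.rVof b h 0 j| <= C * N h) -> 0 <= C ->
  (forall h, N (phi h) <= rho * N h) ->
  spectral_radius (passmx.mxof b b phi) <= rho.
Proof.
move=> bP rho0 bN C0 Nphi; set M := passmx.mxof b b phi.
have pow (a : 'rV[R]_(\dim {: E})) : exists K, forall n j,
    `|iter n (mulmx^~ M) a 0 j| <= K * rho ^+ n.
  exists (C * N (passmx.vecof b a)) => n j.
  have -> : iter n (mulmx^~ M) a = passmx.rVof b (iter n phi (passmx.vecof b a)).
    elim: n => [|n IH] /=; first by rewrite passmx.vecofK.
    by rewrite IH (passmx.rVof_app b bP).
  apply: le_trans (bN _ _) _; rewrite -mulrA; apply: ler_wpM2l => //.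
  elim: n => [|n IH]; first by rewrite expr0 mulr1.
  rewrite iterS exprS mulrCA; apply: le_trans (Nphi _) _.
  by apply: ler_wpM2l.
have ub : ubound [set ComplexField.Normc.normc z | z in
    [set z : R[i] | eigenvalue (map_mx (real_complex R) M) z]] rho.
  move=> _ [z /= /eigenvalueP[w wM w0] <-].
  have zS n : z ^+ n.+1 *: w = (z ^+ n *: w) *m map_mx (real_complex R) M.
    by rewrite exprSr -scalerA -wM scalemxAl.
  have ReM n : map_mx (@complex.Re R) (z ^+ n *: w) =
      iter n (mulmx^~ M) (map_mx (@complex.Re R) w).
    by elim: n => [|n IH]; rewrite ?scale1r // zS Re_mulmx IH.
  have ImM n : map_mx (@complex.Im R) (z ^+ n *: w) =
      iter n (mulmx^~ M) (map_mx (@complex.Im R) w).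
    by elim: n => [|n IH]; rewrite ?scale1r // zS Im_mulmx IH.
  have [j wj] : exists j, w 0 j != 0.
    by apply/existsP; apply: contraR w0 => /existsPn w0;
      apply/eqP/rowP => j; rewrite mxE; apply/eqP; rewrite -[_ == _]negbK w0.
  have [Ka aP] := pow (map_mx (@complex.Re R) w).
  have [Kb bP'] := pow (map_mx (@complex.Im R) w).
  apply: (@growth_rate_le (ComplexField.Normc.normc (w 0 j)) _ _ (Ka + Kb)) => //.
    rewrite lt_def; apply/andP; split; last by case: (w 0 j) => ? ? /=.
    by apply: contra wj => /eqP/ComplexField.Normc.eq0_normc ->.
  move=> n; have := aP n j; have := bP' n j; rewrite -ReM -ImM !mxE => hb ha.
  have normcX m : ComplexField.Normc.normc (z ^+ m) = ComplexField.Normc.normc z ^+ m.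
    elim: m => [|m IH]; first by rewrite !expr0 ComplexField.Normc.normc1.
    by rewrite !exprS ComplexField.Normc.normcM IH.
  rewrite -normcX -ComplexField.Normc.normcM mulrDl.
  exact: le_trans (normc_le_ReIm _) (lerD ha hb).
(* An empty supremum is 0 by convention. *)
rewrite /spectral_radius; set S := [set _ | _ in _] in ub *.
have [->|/set0P S0] := eqVneq S set0; first by rewrite sup0.
exact: ge_sup.
Qed.

End Contraction.

Section LinearBounded.
Context {R : realType} {d : nat}.
Notation E := ('cV[R]_d * Sym R d)%type.

(** Expands the argument in the matrix units, projected onto the symmetric
    matrices for the second component. *)
Lemma linear_map_bounded (W : normedModType R) (T : {linear E -> W}) :
  exists2 C, 0 <= C & forall h, `|T h| <= C * `|h|.
Proof.
pose A := \sum_i `|T (delta_mx i 0, 0)|.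
pose B := \sum_i \sum_j `|T (0, vsproj (symv R d) (delta_mx i j))|.
exists (A + B); first by rewrite addr_ge0 ?sumr_ge0 // => i _; rewrite sumr_ge0.
move=> [x S].
have n1 : `|x| <= `|(x, S)| by rewrite prod_normE le_max lexx.
have n2 : `|S| <= `|(x, S)| by rewrite prod_normE le_max lexx orbT.
have xE : (x, 0) = \sum_i x i 0 *: ((delta_mx i 0, 0) : E).
  have -> : \sum_i x i 0 *: ((delta_mx i 0, 0) : E) =
      (\sum_i x i 0 *: delta_mx i 0, 0).
    elim/big_rec2: _ => // i y1 y2 _ ->.
    by congr pair; rewrite /= scaler0 addr0.
  congr pair; rewrite [LHS]matrix_sum_delta.
  by apply: eq_bigr => i _; rewrite big_ord1.
have SE : (0, S) = \sum_i \sum_j vsval S i j *: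
    ((0, vsproj (symv R d) (delta_mx i j)) : E).
  pose inS (M : 'M[R]_d) : E := (0, vsproj (symv R d) M).
  have lin : linear inS.
    by move=> a u v; rewrite /inS linearP; congr pair; rewrite /= scaler0 addr0.
  pose L : {linear 'M[R]_d -> E} := HB.pack inS (GRing.isLinear.Build _ _ _ _ inS lin).
  have -> : (0, S) = L (vsval S) by rewrite /L /= /inS vsvalK.
  rewrite [X in L X]matrix_sum_delta linear_sum; apply: eq_bigr => i _.
  by rewrite linear_sum; apply: eq_bigr => j _; rewrite linearZ.
set m := `|(x, S)| in n1 n2 *.
have -> : (x, S) = (x, 0) + (0, S) :> E.
  by congr pair; rewrite /= ?addr0 ?add0r.
rewrite linearD mulrDl (le_trans (ler_normD _ _)) //; apply: lerD.
  rewrite xE linear_sum /= (le_trans (ler_norm_sum _ _ _)) // mulr_suml.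
  apply: ler_sum => i _; rewrite linearZ normrZ mulrC ler_wpM2l //.
  exact: le_trans (mx_entry_le _ _ _) n1.
rewrite SE linear_sum /= (le_trans (ler_norm_sum _ _ _)) // mulr_suml.
apply: ler_sum => i _; rewrite linear_sum (le_trans (ler_norm_sum _ _ _)) // mulr_suml.
apply: ler_sum => j _; rewrite linearZ normrZ mulrC ler_wpM2l //.
exact: le_trans (mx_entry_le _ _ _) n2.
Qed.

End LinearBounded.

(** * The reflection through the negative eigenspace *)

Section NegativeEigenspace.
Context {R : realType}.

(** The trace of D = D D is the sum of the squares of the entries of D. *)
Lemma symmetric_idempotent_trace0 n (D : 'M[R]_n) :
  D^T = D -> D *m D = D -> \tr D = 0 -> D = 0.
Proof.
move=> Dt DD trD; have : \sum_i \sum_j D i j ^+ 2 = 0.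
  transitivity (\tr (D *m D)); last by rewrite DD.
  apply: eq_bigr => i _; rewrite mxE; apply: eq_bigr => j _.
  by rewrite -[in D j i]Dt mxE expr2.
move=> /eqP; rewrite psumr_eq0; last by move=> i _; apply: sumr_ge0 => j _; exact: sqr_ge0.
move=> /allP D0; apply/matrixP => i j; rewrite mxE; apply/eqP.
have := D0 i; rewrite mem_index_enum => /(_ isT).
rewrite psumr_eq0; last by move=> l _; exact: sqr_ge0.
by move=> /allP/(_ j); rewrite mem_index_enum sqrf_eq0 => /(_ isT).
Qed.

Lemma trace_orthonormal_sum d k (v : 'I_k -> 'cV[R]_d) :
  (forall i j : 'I_k, (v i)^T *m v j = ((i == j)%:R)%:M) ->
  \tr (\sum_(i < k) v i *m (v i)^T) = k%:R.
Proof.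
move=> vo; rewrite raddf_sum /= (eq_bigr (fun=> 1)) ?sumr_const ?card_ord //.
by move=> i _; rewrite mxtrace_mulC vo eqxx mxtrace_scalar.
Qed.

(** Let Q be the spectral projection on the first k eigenvectors and P the
    projection on the span of the v_i.  The coordinates of v_i on eigenvectors with
    a positive eigenvalue vanish, so Q P = P; then Q - P is a symmetric
    idempotent of trace k - k, hence zero. *)
Lemma reflection_diagonalized d k (V : 'M[R]_d) (l : 'rV[R]_d) (v : 'I_k -> 'cV[R]_d) :
  V^T *m V = 1%:M -> (k <= d)%N ->
  (forall i : 'I_d, (k <= i)%N -> 0 < l 0 i) ->
  (forall i j : 'I_k, (v i)^T *m v j = ((i == j)%:R)%:M) ->
  (forall i : 'I_k, exists2 a : R, a < 0 & V *m diag_mx l *m V^T *m v i = a *: v i) ->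
  1%:M - 2 *: \sum_(i < k) (v i *m (v i)^T) =
  V *m diag_mx (\row_(i < d) if (i < k)%N then -1 else 1) *m V^T.
Proof.
move=> VV kd lpos vo ve; have VVt := mulmx1C VV.
pose P := \sum_(i < k) (v i *m (v i)^T); rewrite -/P.
pose chi : 'rV[R]_d := \row_i (i < k)%N%:R.
pose Q := V *m diag_mx chi *m V^T.
have Qv i : Q *m v i = v i.
  have [a a0 va] := ve i.
  have [u uE] : {u | u = V^T *m v i} by exists (V^T *m v i).
  have lu : diag_mx l *m u = a *: u.
    by rewrite uE scalemxAr -va !mulmxA VV mul1mx.
  have chiu : diag_mx chi *m u = u.
    apply/matrixP => j m; rewrite mul_diag_mx !mxE; case: ltnP => [_|kj]; first by rewrite mul1r.
    have /matrixP/(_ j m) := lu; rewrite mul_diag_mx !mxE => /eqP.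
    rewrite -subr_eq0 -mulrBl mulf_eq0 => /orP[|/eqP->]; last by rewrite mulr0.
    by rewrite subr_eq0 => /eqP la; have := lpos _ kj; rewrite la ltNge ltW.
  by rewrite /Q -!mulmxA -uE chiu uE mulmxA VVt mul1mx.
have QP : Q *m P = P.
  by rewrite /P mulmx_sumr; apply: eq_bigr => i _; rewrite mulmxA Qv.
have Pt : P^T = P.
  by rewrite /P raddf_sum /=; apply: eq_bigr => i _; rewrite trmx_mul trmxK.
have Qt : Q^T = Q by exact: conj_diag_sym.
have PQ : P *m Q = P by rewrite -[RHS]Pt -[in RHS]QP trmx_mul Qt Pt.
have PP : P *m P = P.
  rewrite {1}/P mulmx_suml; apply: eq_bigr => i _.
  rewrite -mulmxA /P mulmx_sumr (bigD1 i) //= big1 => [|j ji].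
    by rewrite addr0 [(v i)^T *m _]mulmxA vo eqxx mul1mx.
  by rewrite mulmxA vo eq_sym (negbTE ji) mulr0n raddf0 mul0mx.
have QQ : Q *m Q = Q.
  rewrite /Q conj_diag_mul //; congr (_ *m diag_mx _ *m _).
  by apply/rowP => i; rewrite !mxE; case: (_ < _)%N; rewrite ?mulr1 ?mulr0.
have trQ : \tr Q = k%:R.
  rewrite /Q mxtrace_mulC mulmxA VV mul1mx mxtrace_diag.
  rewrite (eq_bigr (fun i : 'I_d => if (i < k)%N then 1 else 0)) => [|i _]; last first.
    by rewrite mxE; case: (_ < _)%N.
  by rewrite -big_mkcond /= (big_ord_narrow kd) sumr_const card_ord.
have QPE : Q = P.
  apply/eqP; rewrite -subr_eq0; apply/eqP/symmetric_idempotent_trace0.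
  - by rewrite linearB /= Qt Pt.
  - by rewrite mulmxBl !mulmxBr QQ QP PQ PP subrr subr0.
  - by rewrite raddfB /= trQ trace_orthonormal_sum // subrr.
rewrite -QPE /Q -VVt -{1}[V]mulmx1 -diag_const_mx conj_diag_scale conj_diag_diff.
congr (_ *m diag_mx _ *m _); apply/rowP => i; rewrite !mxE.
by case: (_ < _)%N; rewrite /= ?mulr1 ?mulr0; ring.
Qed.

End NegativeEigenspace.

(** * The derivative of the scheme *)

Section OrthDerivative.
Context {R : realType}.

(** [Orth] is differentiated only along families of symmetric matrices: outside
    them it takes a dummy value.  The formula is the chain rule with the derivative from the quadratic
    estimate [Orth_near_involution]. *)
Lemma is_diff_Orth (W : normedModType R) d k (F dF : W -> 'M[R]_d) (z : W) :
  (forall y, (F y)^T = F y) -> (forall h, (dF h)^T = dF h) ->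
  F z *m F z = 1%:M -> \tr (F z) = d%:R - 2 * k%:R ->
  is_diff z F dF ->
  [/\ vsval (Orth k (F z)) = F z,
      \forall y \near z, in_Orth_domain k (F y)
    & is_diff z (fun y => Orth k (F y))
        (fun h => vsproj (symv R d) (2^-1 *: (dF h - F z *m dF h *m F z)))].
Proof.
move=> Fsym dFsym FF trF Fd; set S := F z.
have [K [r [K0 r0 OrthF]]] := Orth_near_involution (Fsym z) FF trF.
have OS : vsval (Orth k S) = S.
  have := OrthF S (Fsym z); rewrite /= subrr normr0 => /(_ (ltW r0)) [_].
  rewrite mulmx0 mul0mx subrr scaler0 subr0 expr0n /= mulr0 normr_le0 subr_eq0.
  by move=> /eqP.
have Fdiff : differentiable F z by exact: ex_diff.
have nearF : \forall y \near z, `|F y - S| <= r.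
  have /cvgrPdist_le/(_ r r0) := differentiable_continuous Fdiff.
  by apply: filterS => y; rewrite distrC.
split=> //; first by apply: filterS nearF => y /(OrthF _ (Fsym y)) [].
have dFE : dF = 'd F z by rewrite diff_val.
pose P (E : 'M[R]_d) := 2^-1 *: (E - S *m E *m S).
have PL a A B : P (a *: A + B) = a *: P A + P B.
  rewrite /P mulmxDr mulmxDl -scalemxAr -scalemxAl.
  move: (S *m A *m S) (S *m B *m S) => X Y.
  by apply/matrixP => i j; rewrite !mxE; ring.
have PD A B : P (A - B) = P A - P B.
  by rewrite [A - B]addrC -scaleN1r PL scaleN1r addrC.
have Psym A : A^T = A -> (P A)^T = P A.
  by move=> At; rewrite /P linearZ /= linearB /= !trmx_mul At (Fsym z) mulmxA.
pose D : R := 1 + d%:R ^+ 2; have D1 : 1 <= D by rewrite lerDl exprn_ge0.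
have D0 : 0 < D by apply: lt_le_trans D1.
have S1 : `|S| <= 1 by apply: orthogonal_norm_le1; rewrite Fsym.
have Pn A : `|P A| <= D * `|A|.
  rewrite /P normrZ gtr0_norm // ler_pdivrMl //.
  apply: le_trans (ler_normB _ _) _.
  have := mul3mx_norm_le S1 (lexx `|A|) S1; rewrite mul1r mulr1 /D.
  have : 0 <= d%:R ^+ 2 * `|A| by rewrite mulr_ge0 // exprn_ge0.
  by have := normr_ge0 A; nra.
pose J h := vsproj (symv R d) (P (dF h)).
have Jlin : linear J.
  by move=> a u v; rewrite /J dFE linearP PL linearP.
pose L : {linear W -> Sym R d} := HB.pack J (GRing.isLinear.Build _ _ _ _ J Jlin).
have vL h : vsval (L h) = P (dF h) by rewrite /= /J vsproj_sym // Psym.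
have [C C0 dFC] : exists2 C, 0 < C & forall h, `|dF h| <= C * `|h|.
  by rewrite dFE; apply: linear_lipschitz; exact: diff_continuous.
suff : is_diff z (fun y => Orth k (F y)) (L : W -> Sym R d) by [].
apply: is_diff_eps.
  apply: (@lipschitz_linear_continuous _ _ _ _ (D * C)) => h.
  rewrite -[`|L h|]/(`|vsval (L h)|) vL; apply: le_trans (Pn _) _.
  by rewrite -mulrA; apply: ler_wpM2l (dFC h); exact: ltW.
move=> e e0; pose e1 := e / (2 * D).
have e10 : 0 < e1 by rewrite divr_gt0 // mulr_gt0.
(* The error splits in two halves: e1 pays for the linearization of F, and h is
   small enough for the quadratic term K (C + e1)^2 |h|^2. *)
have B0 : 0 < K * (C + e1) ^+ 2 by rewrite mulr_gt0 // exprn_gt0 // addr_gt0.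
have nearF0 : \forall h \near (0 : W), `|F (h + z) - S| <= r.
  move: nearF; rewrite (near_shift 0) subr0; apply: filterS => h //.
near=> h.
have est : `|F (h + z) - S - dF h| <= e1 * `|h|.
  by near: h; exact: is_diff_near.
have Er : `|F (h + z) - S| <= r by near: h.
have [_ Oest] := OrthF (F (h + z)) (Fsym _) Er.
set E := F (h + z) - S in est Er Oest.
have EC : `|E| <= (C + e1) * `|h|.
  rewrite -[E](subrK (dF h)) mulrDl addrC.
  by apply: le_trans (ler_normD _ _) _; apply: lerD.
rewrite -[leLHS]/(`|vsval (Orth k (F (h + z)) - Orth k S - L h)|).
rewrite !linearB /= vL OS.
have -> : vsval (Orth k (F (h + z))) - S - P (dF h) =
    (vsval (Orth k (F (h + z))) - S - P E) + P (E - dF h).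
  by rewrite (PD E) addrA subrK.
apply: le_trans (ler_normD _ _) _; rewrite [e]splitr mulrDl; apply: lerD.
  apply: le_trans Oest _.
  apply: le_trans (_ : K * ((C + e1) * `|h|) ^+ 2 <= _).
    apply: ler_wpM2l; first exact: ltW.
    by apply: lerXn2r => //; rewrite nnegrE // mulr_ge0 // addr_ge0 // ltW.
  rewrite exprMn mulrA [`|h| ^+ 2]expr2 mulrA; apply: ler_wpM2r => //.
  rewrite mulrC -ler_pdivlMr // -[h]subr0 distrC; near: h.
  by apply: cvgr_dist_le => //; rewrite divr_gt0 // divr_gt0.
apply: le_trans (Pn _) _; apply: le_trans (ler_wpM2l (ltW D0) est) _.
rewrite mulrA le_eqVlt; apply/orP; left; apply/eqP; rewrite /e1.
by field; rewrite gt_eqF.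
Unshelve. all: by end_near. Qed.

End OrthDerivative.

Section SchemeDerivative.
Context {R : realType} {d : nat}.
Notation E := ('cV[R]_d * Sym R d)%type.
Variables (f : 'cV[R]_d -> R) (dt : R).

Lemma is_diff_fst (V W : normedModType R) (z : V * W) : is_diff z fst fst.
Proof.
apply: (@is_diff_eps _ _ _ fst fst).
  apply: (@lipschitz_linear_continuous _ _ _ _ 1) => h.
  by rewrite mul1r prod_normE le_max lexx.
by move=> e e0; near=> h; rewrite /= addrK subrr normr0 mulr_ge0 // ltW.
Unshelve. all: by end_near. Qed.

Lemma is_diff_vsval_snd (z : E) :
  is_diff z (fun y => vsval y.2 : 'M[R]_d) (fun h => vsval h.2).
Proof.
have lin : linear (fun h : E => vsval h.2 : 'M[R]_d).
  move=> a u v; exact: (@linearP _ _ _ _ (@vsval R _ (symv R d)) a u.2 v.2).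
pose L : {linear E -> 'M[R]_d} :=
  HB.pack (fun h : E => vsval h.2 : 'M[R]_d) (GRing.isLinear.Build _ _ _ _ _ lin).
suff : is_diff z (fun y => vsval y.2 : 'M[R]_d) L by [].
apply: is_diff_eps.
  apply: (@lipschitz_linear_continuous _ _ _ _ 1) => h.
  by rewrite mul1r prod_normE le_max -[`|h.2|]/(`|vsval h.2|) lexx orbT.
move=> e e0; near=> h.
have -> : vsval (h + z).2 = vsval h.2 + vsval z.2 by [].
rewrite /= addrK subrr normr0.
by rewrite mulr_ge0 // ltW.
Unshelve. all: by end_near. Qed.

Lemma is_diff_scheme_x (z : E) : is_C 2 f -> gradient f z.1 = 0 ->
  is_diff z (fun y => y.1 - dt *: (vsval y.2 *m gradient f y.1))
    (fun h => h.1 - dt *: (vsval z.2 *m (hessian f z.1 *m h.1))).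
Proof.
move=> fC g0; have gd : is_diff z (fun y : E => gradient f y.1)
    (fun h => hessian f z.1 *m h.1).
  exact: (is_diff_comp (is_diff_fst z) (is_diff_gradient z.1 fC)).
have md := is_diff_mulmx (is_diff_vsval_snd z) gd.
apply: is_diff_eq (is_diffB (is_diff_fst z) (is_diffZ dt md)) _.
apply/funext => h; rewrite -[LHS]/(h.1 - dt *: (vsval z.2 *m (hessian f z.1 *m h.1)
  + vsval h.2 *m gradient f z.1)).
by rewrite g0 mulmx0 addr0.
Qed.

Lemma scheme_Rbar_sym (z : E) : is_C 2 f ->
  (scheme_Rbar f dt z)^T = scheme_Rbar f dt z.
Proof.
move=> fC; rewrite /scheme_Rbar linearD /= linearZ /= linearB /= !trmx_mul.
by rewrite !Sym_trmx hessian_sym // mulmxA.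
Qed.

Lemma is_diff_scheme_Rbar (z : E) (dH : {linear 'cV[R]_d -> 'M[R]_d}) :
  is_diff (z.1) (hessian f) dH ->
  let S := vsval z.2 in let H := hessian f z.1 in
  is_diff z (scheme_Rbar f dt) (fun h => vsval h.2 +
    dt *: (dH h.1 - (S *m H *m vsval h.2 + (S *m dH h.1 + vsval h.2 *m H) *m S))).
Proof.
move=> Hd S H; have hd : is_diff z (fun y : E => hessian f y.1) (fun h => dH h.1).
  exact: (is_diff_comp (is_diff_fst z) Hd).
have sd := is_diff_vsval_snd z.
have md := is_diff_mulmx (is_diff_mulmx sd hd) sd.
exact: (is_diffD sd (is_diffZ dt (is_diffB hd md))).
Qed.

End SchemeDerivative.

(** * Contraction in the eigenbasis *)

Section EigenCoordinates.
Context {R : realType} {d : nat}.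
Variable V : 'M[R]_d.
Hypothesis VV : V^T *m V = 1%:M.

Lemma conj_mxM (A B : 'M[R]_d) :
  (V *m A *m V^T) *m (V *m B *m V^T) = V *m (A *m B) *m V^T.
Proof. by rewrite -!mulmxA (mulmxA V^T) VV mul1mx !mulmxA. Qed.

Lemma conj_mxK (A : 'M[R]_d) : V^T *m (V *m A *m V^T) *m V = A.
Proof. by rewrite !mulmxA VV mul1mx -mulmxA VV mulmx1. Qed.

Lemma conj_mxVK (A : 'M[R]_d) : V *m (V^T *m A *m V) *m V^T = A.
Proof.
by rewrite !mulmxA (mulmx1C VV) mul1mx -mulmxA (mulmx1C VV) mulmx1.
Qed.

Lemma conj_mxD (A B : 'M[R]_d) :
  V *m A *m V^T + V *m B *m V^T = V *m (A + B) *m V^T.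
Proof. by rewrite mulmxDr mulmxDl. Qed.

Lemma conj_mxB (A B : 'M[R]_d) :
  V *m A *m V^T - V *m B *m V^T = V *m (A - B) *m V^T.
Proof. by rewrite mulmxBr mulmxBl. Qed.

Lemma conj_mxZ a (A : 'M[R]_d) : a *: (V *m A *m V^T) = V *m (a *: A) *m V^T.
Proof. by rewrite -scalemxAr -scalemxAl. Qed.

Lemma pm1_of_square (s : 'rV[R]_d) a : s 0 a * s 0 a = 1 -> s 0 a = 1 \/ s 0 a = -1.
Proof.
move=> /eqP; rewrite -subr_eq0.
have -> : s 0 a * s 0 a - 1 = (s 0 a - 1) * (s 0 a + 1) by ring.
by rewrite mulf_eq0 subr_eq0 addr_eq0 => /orP[]/eqP; [left | right].
Qed.

(** In eigencoordinates E |-> (E - S E S) / 2 multiplies the entry (i, j) by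
    (1 - s_i s_j) / 2, which is 0 or 1.  When it is 1, s_i s_j = -1, so that the
    two terms in G reinforce each other. *)
Lemma scheme_R_coordinates (s l : 'rV[R]_d) (dt : R) (sigma G : 'M[R]_d) i j :
  (forall i, s 0 i * s 0 i = 1) ->
  let S := V *m diag_mx s *m V^T in let H := V *m diag_mx l *m V^T in
  let M := sigma + dt *: (G - (S *m H *m sigma + (S *m G + sigma *m H) *m S)) in
  (V^T *m (2^-1 *: (M - S *m M *m S)) *m V) i j =
  (1 - s 0 i * s 0 j) / 2 * ((1 - dt * (s 0 i * l 0 i + s 0 j * l 0 j)) *
    (V^T *m sigma *m V) i j + 2 * dt * (V^T *m G *m V) i j).
Proof.
move=> ss S H M.
have [t tE] : {t | t = V^T *m sigma *m V} by exists (V^T *m sigma *m V).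
have [g gE] : {g | g = V^T *m G *m V} by exists (V^T *m G *m V).
rewrite -tE -gE /M -(conj_mxVK sigma) -(conj_mxVK G) -tE -gE /S /H.
rewrite !(conj_mxM, conj_mxD, conj_mxB, conj_mxZ) conj_mxK.
rewrite !(mulmxDl, mulmxDr, mulmxBl, mulmxBr).
rewrite !(mulmxA, mulmx_diag, mul_diag_mx, mul_mx_diag) !mxE.
have pm a := pm1_of_square (ss a).
by case: (pm i) => ->; case: (pm j) => ->; field.
Qed.

Lemma norm_conj_le (A : 'M[R]_d) : `|V *m A *m V^T| <= d%:R ^+ 2 * `|A|.
Proof.
have V1 := orthogonal_norm_le1 VV.
have := mul3mx_norm_le V1 (lexx `|A|) (_ : `|V^T| <= 1).
by rewrite mul1r mulr1; apply; rewrite trmx_norm.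
Qed.

Lemma norm_conjV_le (A : 'M[R]_d) : `|V^T *m A *m V| <= d%:R ^+ 2 * `|A|.
Proof.
have V1 := orthogonal_norm_le1 VV.
have := mul3mx_norm_le (_ : `|V^T| <= 1) (lexx `|A|) V1.
by rewrite mul1r mulr1; apply; rewrite trmx_norm.
Qed.

Lemma norm_rot_le (x : 'cV[R]_d) : `|V *m x| <= d%:R * `|x|.
Proof.
apply: le_trans (mulmx_norm_le _ _) _; apply: ler_wpM2r => //.
by rewrite ler_piMr // orthogonal_norm_le1.
Qed.

Lemma norm_rotV_le (x : 'cV[R]_d) : `|V^T *m x| <= d%:R * `|x|.
Proof.
apply: le_trans (mulmx_norm_le _ _) _; apply: ler_wpM2r => //.
by rewrite ler_piMr // trmx_norm orthogonal_norm_le1.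
Qed.

(** The weight is taken small, so that the coupling of the second component to
    the first costs less than the contraction of the first. *)
Definition eigen_norm (eps : R) (h : 'cV[R]_d * Sym R d) : R :=
  `|V^T *m h.1| + eps * `|V^T *m vsval h.2 *m V|.

Lemma eigen_norm_triangle eps x y : 0 <= eps ->
  eigen_norm eps (x + y) <= eigen_norm eps x + eigen_norm eps y.
Proof.
move=> e0; rewrite /eigen_norm.
have -> : vsval (x + y).2 = vsval x.2 + vsval y.2 by [].
have -> : (x + y).1 = x.1 + y.1 by [].
rewrite !mulmxDr mulmxDl addrACA -mulrDr.
apply: lerD; first exact: ler_normD.
by apply: ler_wpM2l => //; exact: ler_normD.
Qed.

Lemma eigen_norm_upper eps x : 0 <= eps ->
  eigen_norm eps x <= (d%:R + eps * d%:R ^+ 2) * `|x|.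
Proof.
move=> e0; have n1 : `|x.1| <= `|x| by rewrite prod_normE le_max lexx.
have n2 : `|vsval x.2| <= `|x|.
  by rewrite -[`|vsval x.2|]/(`|x.2|) prod_normE le_max lexx orbT.
rewrite mulrDl; apply: lerD.
  by apply: le_trans (norm_rotV_le _) _; apply: ler_wpM2l.
rewrite -mulrA; apply: ler_wpM2l => //.
apply: le_trans (norm_conjV_le _) _; exact: ler_wpM2l.
Qed.

Lemma eigen_norm_lower eps x : 0 < eps ->
  (1 + d%:R + d%:R ^+ 2 / eps)^-1 * `|x| <= eigen_norm eps x.
Proof.
move=> e0; set D : R := d%:R; have D0 : 0 <= D by [].
have D20 : 0 <= D ^+ 2 / eps by rewrite divr_ge0 ?exprn_ge0 // ltW.
have c0 : 0 < 1 + D + D ^+ 2 / eps by rewrite -addrA ltr_wpDr // addr_ge0.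
rewrite ler_pdivrMl // /eigen_norm.
set a := `|V^T *m x.1|; set b := `|V^T *m vsval x.2 *m V|.
have a0 : 0 <= a by exact: normr_ge0.
have b0 : 0 <= b by exact: normr_ge0.
have n1 : `|x.1| <= D * a.
  apply: le_trans (norm_rot_le _).
  by rewrite mulmxA (mulmx1C VV) mul1mx.
have n2 : `|x.2| <= D ^+ 2 * b.
  by apply: le_trans (norm_conj_le _); rewrite conj_mxVK.
have E2 : (1 + D + D ^+ 2 / eps) * (a + eps * b) =
    (a + eps * b) + D * a + D * (eps * b) + D ^+ 2 / eps * a + D ^+ 2 * b.
  by field; rewrite gt_eqF.
have p1 : 0 <= D * (eps * b) by rewrite !mulr_ge0 // ltW.
have p2 : 0 <= eps * b by rewrite mulr_ge0 // ltW.
have p3 : 0 <= D ^+ 2 / eps * a by rewrite mulr_ge0.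
have p4 : 0 <= D * a by rewrite mulr_ge0.
have p5 : 0 <= D ^+ 2 * b by rewrite mulr_ge0 // exprn_ge0.
rewrite prod_normE ge_max E2; apply/andP; split; first by move: n1; lra.
by move: n2; lra.
Qed.

(** Both diagonal blocks contract by 1 - dt mu, and the coupling contributes at
    most K times the first norm; the weight is chosen such that eps K is at most
    half of the gap dt mu. *)
Lemma eigen_norm_contracts (s l : 'rV[R]_d) (dt L mu : R) (G : 'cV[R]_d -> 'M[R]_d)
    (C : R) :
  (forall i, s 0 i * s 0 i = 1) -> (forall i, mu <= s 0 i * l 0 i <= L) ->
  0 < mu -> mu <= L -> 0 < dt -> 2 * L * dt < 1 -> 0 <= C ->
  (forall x, `|G x| <= C * `|x|) ->
  let S := V *m diag_mx s *m V^T in let H := V *m diag_mx l *m V^T in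
  let M h := vsval h.2 +
    dt *: (G h.1 - (S *m H *m vsval h.2 + (S *m G h.1 + vsval h.2 *m H) *m S)) in
  forall J : 'cV[R]_d * Sym R d -> 'cV[R]_d * Sym R d,
  (forall h, (J h).1 = h.1 - dt *: (S *m (H *m h.1))) ->
  (forall h, vsval (J h).2 = 2^-1 *: (M h - S *m M h *m S)) ->
  exists eps rho : R, [/\ 0 < eps, 0 <= rho, rho < 1 &
    forall h, eigen_norm eps (J h) <= rho * eigen_norm eps h].
Proof.
move=> ss sl mu0 muL dt0 Ldt C0 GC S H M J J1 J2.
pose rho0 := 1 - dt * mu.
have dL : 2 * (dt * L) < 1 by move: Ldt; congr (_ < _); ring.
have dsl i : dt * mu <= dt * (s 0 i * l 0 i) <= dt * L.
  by have /andP[h1 h2] := sl i; rewrite !ler_pM2l // h1.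
have bnd i : 0 <= 1 - dt * (s 0 i * l 0 i) <= rho0.
  have := dsl i; rewrite /rho0; move: (dt * (s 0 i * l 0 i)) => x /andP[h1 h2].
  by apply/andP; split; lra.
have bnd2 i j : `|1 - dt * (s 0 i * l 0 i + s 0 j * l 0 j)| <= rho0.
  have dm : 0 < dt * mu by exact: mulr_gt0.
  have := dsl i; have := dsl j; rewrite mulrDr /rho0.
  move: (dt * (s 0 i * l 0 i)) (dt * (s 0 j * l 0 j)) => x y /andP[h1 h2] /andP[h3 h4].
  by rewrite ger0_norm; lra.
pose D : R := d%:R; have D0 : 0 <= D by [].
pose K := 2 * dt * (D ^+ 2 * (C * D)).
have K0 : 0 <= K.
  apply: mulr_ge0; first by apply: mulr_ge0 => //; exact: ltW.
  by apply: mulr_ge0; [exact: exprn_ge0 | exact: mulr_ge0].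
have r0 : 0 <= rho0.
  have dmL : dt * mu <= dt * L by rewrite ler_pM2l.
  by rewrite /rho0; lra.
have dm : 0 < dt * mu by exact: mulr_gt0.
pose eps := dt * mu / (2 * (K + 1)).
have K2 : 0 < 2 * (K + 1) by rewrite mulr_gt0 // ltr_wpDl.
have e0 : 0 < eps by exact: divr_gt0.
have eK : eps * K <= dt * mu / 2.
  rewrite /eps mulrAC ler_pdivrMr //.
  have : 0 <= dt * mu * K by rewrite mulr_ge0 // ltW.
  by nra.
exists eps, ((1 + rho0) / 2); split=> //.
- by apply: divr_ge0 => //; apply: addr_ge0.
- by rewrite /rho0; lra.
move=> h; rewrite /eigen_norm.
set a := `|V^T *m h.1|; set b := `|V^T *m vsval h.2 *m V|.
have a0 : 0 <= a by exact: normr_ge0.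
have b0 : 0 <= b by exact: normr_ge0.
have A1 : `|V^T *m (J h).1| <= rho0 * a.
  rewrite J1 mulmxA conj_mxM mulmx_diag mulmxBr -scalemxAr !mulmxA VV mul1mx.
  rewrite -[_ *m V^T *m h.1]mulmxA.
  have : forall i j, `|(V^T *m h.1) i j| <= a by move=> i j; exact: mx_entry_le.
  move: (V^T *m h.1) => y ya; apply: mx_norm_le => [|i j]; first exact: mulr_ge0.
  rewrite mul_diag_mx !mxE.
  have -> : y i j - dt * (s 0 i * l 0 i * y i j) = (1 - dt * (s 0 i * l 0 i)) * y i j.
    by ring.
  have /andP[h1 h2] := bnd i.
  by rewrite normrM ger0_norm //; apply: ler_pM.
have hx : `|h.1| <= D * a.
  by apply: le_trans (norm_rot_le _); rewrite mulmxA (mulmx1C VV) mul1mx.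
have A2 : `|V^T *m vsval (J h).2 *m V| <= rho0 * b + K * a.
  apply: mx_norm_le => [|i j]; first by rewrite addr_ge0 // mulr_ge0.
  rewrite J2 scheme_R_coordinates // normrM.
  have g1 : `|(V^T *m G h.1 *m V) i j| <= D ^+ 2 * (C * D) * a.
    apply: le_trans (mx_entry_le _ _ _) _; apply: le_trans (norm_conjV_le _) _.
    have -> : D ^+ 2 * (C * D) * a = D ^+ 2 * (C * (D * a)) by ring.
    apply: ler_wpM2l; first exact: exprn_ge0.
    by apply: le_trans (GC _) _; exact: ler_wpM2l.
  have c1 : `|(1 - s 0 i * s 0 j) / 2| <= 1.
    have pm m := pm1_of_square (ss m).
    by rewrite ler_norml; case: (pm i) => ->; case: (pm j) => ->; apply/andP; split; lra.
  rewrite -[leRHS]mul1r; apply: ler_pM => //.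
  apply: le_trans (ler_normD _ _) _; rewrite !normrM; apply: lerD.
    by apply: ler_pM => //; exact: mx_entry_le.
  rewrite [`|2|]ger0_norm // [`|dt|]ger0_norm ?(ltW dt0) // /K -[leRHS]mulrA.
  by apply: ler_wpM2l g1; rewrite mulr_ge0 // ltW.
apply: le_trans (lerD A1 (ler_wpM2l (ltW e0) A2)) _.
have q1 : eps * K * a <= dt * mu / 2 * a by exact: ler_wpM2r.
have q2 : 0 <= dt * mu * (eps * b) := mulr_ge0 (ltW dm) (mulr_ge0 (ltW e0) b0).
by rewrite /rho0; move: q1 q2; nra.
Qed.

End EigenCoordinates.

Theorem proposition5p3 (R : realType) (d k : nat) (f : 'cV[R]_d -> R)
    (xs : 'cV[R]_d) (delta L mu dt : R)
    (v : 'I_k -> 'cV[R]_d) (Rs : Sym R d)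
  (hk : (1 <= k <= d.-1)%N)
  (hf : smooth f)
  (hxs : index_saddle k f xs)
  (hdelta : 0 < delta)
  (hmu : 0 < mu)
  (hL : mu <= L)
  (hspec : forall x : 'cV[R]_d, norm2 (x - xs) <= delta ->
    exists2 l : d.-tuple R, is_spectrum (hessian f x) l &
      forall i : 'I_d,
        ((i < k)%N -> - L <= tnth l i <= - mu) /\
        ((k <= i)%N -> mu <= tnth l i <= L))
  (hv_orthonormal : forall i j : 'I_k, (v i)^T *m v j = ((i == j)%:R)%:M)
  (hv_eigen : forall i : 'I_k,
    exists2 a : R, a < 0 & hessian f xs *m v i = a *: v i)
  (hRs : vsval Rs = 1%:M - 2 *: \sum_(i < k) (v i *m (v i)^T))
  (hdt : 0 < dt < (2 * L)^-1) :
  [/\ (\forall z \near (xs, Rs), in_Orth_domain k (scheme_Rbar f dt z)),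
      locally_contractive (scheme_map f k dt) (xs, Rs)
    & asymptotically_linearly_stable (scheme_map f k dt) (xs, Rs)].
Proof.
have /andP[dt0 dtL] := hdt; have /andP[_ kd1] := hk.
have kd : (k <= d)%N by apply: leq_trans kd1 (leq_pred d).
have L0 : 0 < L by apply: lt_le_trans hL.
have fC2 : is_C 2 f by exact: hf.
have fC3 : is_C 3 f by exact: hf.
have [g0 _] := hxs; pose H := hessian f xs.
have Hsym : H^T = H by exact: hessian_sym.
have [l [_ lchar] lP] : exists2 l : d.-tuple R, is_spectrum H l &
      forall i : 'I_d,
        ((i < k)%N -> - L <= tnth l i <= - mu) /\
        ((k <= i)%N -> mu <= tnth l i <= L).
  apply: hspec; rewrite subrr /norm2 big1 ?sqrtr0 ?ltW // => i _.
  by rewrite mxE expr0n.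
have [V VV HV] := diagonalization_by_roots Hsym lchar.
set lam := \row_i tnth l i in HV.
pose s : 'rV[R]_d := \row_(i < d) if (i < k)%N then -1 else 1.
have lamP (i : 'I_d) : if (i < k)%N then - L <= lam 0 i <= - mu else mu <= lam 0 i <= L.
  have [l1 l2] := lP i; rewrite !mxE; case: ltnP => ik; [exact: l1 | exact: l2].
have ss i : s 0 i * s 0 i = 1.
  by rewrite !mxE; case: (_ < _)%N; rewrite ?mulrNN mulr1.
have sl i : mu <= s 0 i * lam 0 i <= L.
  have := lamP i; rewrite [s 0 i]mxE; case: (_ < _)%N; rewrite ?mulN1r ?mul1r //.
  by rewrite lerNr lerNl andbC.
(* R* is the sign of the Hessian, in the eigenbasis of the Hessian. *)
have RsV : vsval Rs = V *m diag_mx s *m V^T.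
  rewrite hRs; apply: (reflection_diagonalized VV kd _ hv_orthonormal) => [i ki|i].
    have := lamP i; rewrite ltnNge ki /= => /andP[h _].
    exact: lt_le_trans hmu h.
  by have [a a0 Ha] := hv_eigen i; exists a => //; rewrite -HV.
have RR : vsval Rs *m vsval Rs = 1%:M.
  rewrite RsV conj_diag_mul // (_ : \row_i _ = const_mx 1).
    by rewrite diag_const_mx mulmx1 (mulmx1C VV).
  by apply/rowP => i; rewrite !mxE -[RHS](ss i) !mxE.
have trR : \tr (vsval Rs) = d%:R - 2 * k%:R.
  rewrite hRs raddfB /= mxtrace1 linearZ /= trace_orthonormal_sum //.
have RHR : vsval Rs *m H *m vsval Rs = H.
  rewrite HV RsV !conj_diag_mul //; congr (_ *m diag_mx _ *m _).
  by apply/rowP => i; rewrite 2!mxE mulrAC ss mul1r.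
have RbarE : scheme_Rbar f dt (xs, Rs) = vsval Rs.
  by rewrite /scheme_Rbar /= RHR subrr scaler0 addr0.
have [dH Hd [dHc dHsym]] := is_diff_hessian xs fC3.
have [C C0 dHC] := linear_lipschitz dHc.
pose S := vsval Rs.
(* The differential of the unprojected update of R. *)
pose dR (h : 'cV[R]_d * Sym R d) := vsval h.2 +
  dt *: (dH h.1 - (S *m H *m vsval h.2 + (S *m dH h.1 + vsval h.2 *m H) *m S)).
have Rd : is_diff (xs, Rs) (scheme_Rbar f dt) dR.
  exact: (@is_diff_scheme_Rbar R d f dt (xs, Rs) dH Hd).
have dRsym h : (dR h)^T = dR h.
  have tD (A B : 'M[R]_d) : (A + B)^T = A^T + B^T by rewrite linearD.
  have tB (A B : 'M[R]_d) : (A - B)^T = A^T - B^T by rewrite linearB.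
  have tZ a (A : 'M[R]_d) : (a *: A)^T = a *: A^T by rewrite linearZ.
  rewrite /dR !(tB, tD, tZ, trmx_mul) /S !Sym_trmx dHsym Hsym -/S.
  congr (_ + _ *: (_ - _)); rewrite !mulmxDl !mulmxDr !mulmxA.
  by rewrite addrC -addrA addrC -!addrA; congr (_ + _); rewrite addrC.
have [OrthE domO Od] : [/\ vsval (Orth k (scheme_Rbar f dt (xs, Rs))) = scheme_Rbar f dt (xs, Rs),
    \forall y \near (xs, Rs), in_Orth_domain k (scheme_Rbar f dt y)
  & is_diff (xs, Rs) (fun y => Orth k (scheme_Rbar f dt y))
     (fun h => vsproj (symv R d) (2^-1 *: (dR h - vsval Rs *m dR h *m vsval Rs)))].
  have := is_diff_Orth (k := k) (fun z => scheme_Rbar_sym dt z fC2) dRsym _ _ Rd.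
  by rewrite RbarE; apply.
have xd := is_diff_scheme_x dt fC2 (g0 : gradient f (xs, Rs).1 = 0).
pose J (h : 'cV[R]_d * Sym R d) : 'cV[R]_d * Sym R d :=
  (h.1 - dt *: (S *m (H *m h.1)), vsproj (symv R d) (2^-1 *: (dR h - S *m dR h *m S))).
have Phid : is_diff (xs, Rs) (scheme_map f k dt) J by exact: (is_diff_pair xd Od).
have Phi_fix : scheme_map f k dt (xs, Rs) = (xs, Rs).
  rewrite /scheme_map /= g0 mulmx0 scaler0 subr0; congr pair.
  by apply: val_inj; rewrite /= OrthE RbarE.
have Ldt : 2 * L * dt < 1.
  by move: dtL; rewrite -ltr_pdivlMl ?mulr_gt0 // mulr1.
have J2 h : vsval (J h).2 = 2^-1 *: (dR h - vsval Rs *m dR h *m vsval Rs).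
  rewrite /J /= vsproj_sym //; rewrite linearZ /= linearB /= !trmx_mul.
  by rewrite dRsym Sym_trmx mulmxA.
have [eps [rho [eps0 rho0 rho1 contr]]] :
    exists eps rho : R, [/\ 0 < eps, 0 <= rho, rho < 1 &
      forall h, eigen_norm V eps (J h) <= rho * eigen_norm V eps h].
  apply: (@eigen_norm_contracts R d V VV s lam dt L mu dH C ss sl hmu hL dt0 Ldt
    (ltW C0) dHC J) => h; rewrite -RsV -HV //.
have cpos := eigen_norm_lower VV _ eps0.
have upper h := eigen_norm_upper VV h (ltW eps0).
set c := (1 + d%:R + d%:R ^+ 2 / eps)^-1 in cpos.
have c0 : 0 < c.
  rewrite invr_gt0 -addrA ltr_wpDr // addr_ge0 // divr_ge0 ?exprn_ge0 //.
  exact: ltW.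
split=> //.
- split=> //.
  apply: le_lt_trans rho1; rewrite /jacobian_mx.
  pose b := vbasis {: ('cV[R]_d * Sym R d)%type}.
  (* Linearity is restated because the coordinate map is linear for the vector
     space structure, whereas boundedness refers to the normed one. *)
  have lin : linear (passmx.rVof b : 'cV[R]_d * Sym R d -> 'rV[R]__).
    exact: passmx.rVof_linear.
  pose T : {linear ('cV[R]_d * Sym R d)%type -> 'rV[R]__} :=
    HB.pack (passmx.rVof b) (GRing.isLinear.Build _ _ _ _ (passmx.rVof b) lin).
  have [B B0 bB] := linear_map_bounded T.
  apply: (@spectral_radius_le _ _ _ _ (eigen_norm V eps) _ (B / c)) => //.
  + exact: vbasisP.
  + move=> h j; apply: le_trans (mx_entry_le _ _ _) _.
    apply: le_trans (bB h) _; rewrite -mulrA; apply: ler_wpM2l => //.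
    by rewrite ler_pdivlMl.
  + by rewrite divr_ge0 // ltW.
  + by move=> h; rewrite lfunE /= diff_val.
- apply: (@adapted_norm_linear_stability _ _ (eigen_norm V eps) c (d%:R + eps * d%:R ^+ 2 + 1) rho _ J) => //.
  + by move=> x y; apply: eigen_norm_triangle => //; exact: ltW.
  + by rewrite ltr_wpDl // addr_ge0 // mulr_ge0 ?exprn_ge0 // ltW.
  + move=> h; apply: le_trans (upper h) _; apply: ler_wpM2r => //.
    by rewrite lerDl.
Qed.
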